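(* Let $(A,\mathfrak{m})$ be a commutative Noetherian local ring, let $M$ be a finitely generated $A$-module with $\dim M>0$, let $I$ be an $\mathfrak{m}$-primary ideal of $A$, and let $X_\bullet$ be a non-zero object of $K^b(\operatorname{proj} A)$. Let $s_I^M(X_\bullet)$ be the degree of the function of polynomial type $$\psi_{X_\bullet}^{M,I}(n)=\sum_{i\in\mathbb{Z}}\ell\big(H^i(X_\bullet\otimes_A M/I^nM)\big),\qquad n\ge 1.$$ Then $$s_I^M(X_\bullet)=\max\{\dim H^*(X_\bullet\otimes_A M),\ \dim M-1\}.$$
   Context: $\ell(\cdot)$ denotes length. $K^b(\operatorname{proj} A)$ is the homotopy category of bounded complexes of finitely generated projective $A$-modules (complexes indexed cohomologically); an object is non-zero if it is not isomorphic to $0$ in this category, equivalently its cohomology is not identically zero. $H^*(Y_\bullet)=\bigoplus_{i\in\mathbb{Z}}H^i(Y_\bullet)$, and $\dim$ denotes Krull dimension of a module. A function $f:\mathbb{Z}_{\ge1}\to\mathbb{Z}$ is of polynomial type if it agrees with a polynomial in $\mathbb{Q}[n]$ for all $n\gg0$; its degree is the degree of that polynomial. Since $I$ is $\mathfrak{m}$-primary, the lengths above are finite, and $\psi_{X_\bullet}^{M,I}$ is known to be of polynomial type. *)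

(* Defs.v *)
From HB Require Import structures.
From mathcomp Require Import all_boot all_order all_algebra.
From mathcomp Require Import boolp classical_sets functions cardinality fsbigop.
From mathcomp Require Import constructive_ereal ereal.
Set Implicit Arguments.
Unset Strict Implicit.
Unset Printing Implicit Defensive.
Import Order.TTheory GRing.Theory Num.Theory.
Local Open Scope classical_set_scope.
Local Open Scope quotient_scope.
Local Open Scope ring_scope.

(* Submodules and ideals are boolean predicates; under the classical axioms   *)
(* of boolp every subset is of this form.                                      *)

Section Span.
Variables (A : comNzRingType) (V : lmodType A).

Definition span (S : set V) : {pred V} := fun x =>
  `[< forall U : {pred V}, submod_closed U -> S `<=` [set` U] -> x \in U >].

Lemma span_submod (S : set V) : subsemimod_closed (span S).
Proof.
apply: GRing.submod_closed_semi; split=> [|a x y].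
  by apply/asboolP => U [].
move=> /asboolP xS /asboolP yS; apply/asboolP => U Umod SU.
by apply: Umod.2; [exact: xS | exact: yS].
Qed.

HB.instance Definition _ (S : set V) :=
  GRing.isSubmodClosed.Build A V (span S) (span_submod S).

Lemma sub_span (S : set V) x : S x -> x \in span S.
Proof. by move=> Sx; apply/asboolP => U _; apply. Qed.

Lemma span_sub (S : set V) (U : submodClosed V) :
  S `<=` [set` U] -> {subset span S <= U}.
Proof. by move=> SU x /asboolP; apply => //; exact: submodClosedP. Qed.

(* J U, the submodule generated by the products a x with a in J, x in U *)
Definition smul (J : {pred A}) (U : {pred V}) : {pred V} :=
  span [set y | exists a x, [/\ a \in J, x \in U & y = a *: x]].

HB.instance Definition _ (J : {pred A}) (U : {pred V}) :=
  GRing.SubmodClosed.on (smul J U).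

Definition fg_submod (U : {pred V}) : Prop :=
  exists s : seq V, U =i span [set` s].

Definition annihilator : {pred A} := fun a => `[< forall x : V, a *: x = 0 >].

End Span.

Definition fg_module (A : comNzRingType) (V : lmodType A) : Prop :=
  fg_submod (predT : {pred V}).

Section Modules.
Variables (A : comNzRingType) (V W : lmodType A).

Section Kernel.
Variable f : {linear V -> W}.

Definition ker : {pred V} := fun x => f x == 0.

Lemma ker_submod : subsemimod_closed ker.
Proof.
apply: GRing.submod_closed_semi; split=> [|a x y]; rewrite !unfold_in.
  by rewrite linear0.
by move=> /eqP fx /eqP fy; rewrite linearP fx fy scaler0 addr0.
Qed.

HB.instance Definition _ := GRing.isSubmodClosed.Build A V ker ker_submod.

Definition im : {pred W} := fun y => `[< exists x, y = f x >].

Lemma im_submod : subsemimod_closed im.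
Proof.
apply: GRing.submod_closed_semi; split=> [|a y z].
  by apply/asboolP; exists 0; rewrite linear0.
move=> /asboolP[x ->] /asboolP[t ->]; apply/asboolP.
by exists (a *: x + t); rewrite linearP.
Qed.

HB.instance Definition _ := GRing.isSubmodClosed.Build A W im im_submod.
End Kernel.

Section Preimage.
Variables (f : {linear V -> W}) (U : submodClosed W).

Definition preim_submod : {pred V} := fun x => f x \in U.

Lemma preim_submod_closed : subsemimod_closed preim_submod.
Proof.
apply: GRing.submod_closed_semi; split=> [|a x y].
  by change (f 0 \in U); rewrite linear0 rpred0.
rewrite -![_ \in preim_submod]/(f _ \in U) => fx fy.
by rewrite linearP rpredD // rpredZ.
Qed.

HB.instance Definition _ :=
  GRing.isSubmodClosed.Build A V preim_submod preim_submod_closed.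
End Preimage.

End Modules.

(* [submodClosed V] does not inherit from [zmodClosed V] in MathComp 2.5, as   *)
(* it is also meant for semimodules; this alias supplies the instance.         *)
Section ZmodPred.
Variables (A : comNzRingType) (V : lmodType A) (U : submodClosed V).
Definition zmod_pred : {pred V} := U.
HB.instance Definition _ :=
  GRing.isSubmodClosed.Build A V zmod_pred (GRing.subsemimodClosedP U).
End ZmodPred.

Section Submodule.
Variables (A : comNzRingType) (V : lmodType A) (U : submodClosed V).

Record submod := Submod { submod_val : V; submod_valP : submod_val \in U }.

HB.instance Definition _ := [isSub for submod_val].
HB.instance Definition _ := [Choice of submod by <:].
HB.instance Definition _ := [SubChoice_isSubLmodule of submod by <:].

End Submodule.

Section QuotientModule.
Variables (A : comNzRingType) (V : lmodType A) (U : submodClosed V).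

Definition modquot : Type := Quotient.quot (zmod_pred U).

HB.instance Definition _ := GRing.Zmodule.on modquot.

Definition modquot_pi (x : V) : modquot := \pi_(Quotient.quot (zmod_pred U)) x.

Lemma modquot_pi_eq x y : (modquot_pi x = modquot_pi y) <-> (x - y \in U).
Proof.
change (x - y \in U) with (x - y \in zmod_pred U).
by rewrite Quotient.idealrBE; split=> /eqP.
Qed.

Lemma modquot_piB : {morph modquot_pi : x y / x - y}.
Proof. exact: pi_is_zmod_morphism. Qed.

Lemma modquot_piD : {morph modquot_pi : x y / x + y}.
Proof. by move=> x y; rewrite /modquot_pi !piE. Qed.

Definition modquot_repr (x : modquot) : V := repr (x : Quotient.quot (zmod_pred U)).

Lemma modquot_reprK : cancel modquot_repr modquot_pi.
Proof. exact: reprK. Qed.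

Definition modquot_scale (a : A) (x : modquot) : modquot :=
  modquot_pi (a *: modquot_repr x).

Lemma modquot_scale_pi a x :
  modquot_scale a (modquot_pi x) = modquot_pi (a *: x).
Proof.
apply/modquot_pi_eq; rewrite -scalerBr rpredZ //.
by apply/modquot_pi_eq; rewrite modquot_reprK.
Qed.

Lemma modquot_scaleA a b x :
  modquot_scale a (modquot_scale b x) = modquot_scale (a * b) x.
Proof. by rewrite -[x]modquot_reprK !modquot_scale_pi scalerA. Qed.

Lemma modquot_scale1 : left_id 1 modquot_scale.
Proof. by move=> x; rewrite -[x]modquot_reprK !modquot_scale_pi scale1r. Qed.

Lemma modquot_scaleDr : right_distributive modquot_scale +%R.
Proof.
move=> a x y; rewrite -[x]modquot_reprK -[y]modquot_reprK.
by rewrite -modquot_piD !modquot_scale_pi scalerDr modquot_piD.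
Qed.

Lemma modquot_scaleDl x : {morph modquot_scale^~ x : a b / a + b}.
Proof.
by move=> a b; rewrite -[x]modquot_reprK !modquot_scale_pi scalerDl modquot_piD.
Qed.

HB.instance Definition _ := GRing.Zmodule_isLmodule.Build A modquot
  modquot_scaleA modquot_scale1 modquot_scaleDr modquot_scaleDl.

Lemma modquot_pi_linear : linear modquot_pi.
Proof. by move=> a x y; rewrite modquot_piD -modquot_scale_pi. Qed.

HB.instance Definition _ :=
  GRing.isLinear.Build A V modquot _ modquot_pi modquot_pi_linear.

End QuotientModule.

Section QuotientLift.
Variables (A : comNzRingType) (V W : lmodType A) (U : submodClosed V).
Variable f : {linear V -> W}.
Hypothesis fU : {subset U <= ker f}.

(* The proof that f kills U is an argument so that this is always linear. *)
Definition modquot_lift of {subset U <= ker f} : modquot U -> W :=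
  fun x => f (modquot_repr x).

Lemma modquot_lift_pi x : modquot_lift fU (modquot_pi U x) = f x.
Proof.
apply/eqP; rewrite -subr_eq0 -linearB; apply: fU.
by apply/modquot_pi_eq; rewrite modquot_reprK.
Qed.

Lemma modquot_lift_linear : linear (modquot_lift fU).
Proof.
move=> a x y; rewrite -[x]modquot_reprK -[y]modquot_reprK -linearP.
by rewrite !modquot_lift_pi linearP.
Qed.

HB.instance Definition _ := GRing.isLinear.Build A (modquot U) W _
  (modquot_lift fU) modquot_lift_linear.

End QuotientLift.

Section DirectSum.
Variables (A : comNzRingType) (I : choiceType) (V : I -> lmodType A).

Record dsum := Dsum {
  dsum_fun :> forall i, V i;
  dsum_finite : exists s : seq I, forall i, i \notin s -> dsum_fun i = 0 }.

HB.instance Definition _ := gen_eqMixin dsum.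
HB.instance Definition _ := gen_choiceMixin dsum.

Lemma dsumP (x y : dsum) : (forall i, x i = y i) -> x = y.
Proof.
case: x y => [x xs] [y ys] /= xy0.
have xy : x = y by exact: functional_extensionality_dep.
by subst y; congr Dsum; exact: Prop_irrelevance.
Qed.

Lemma dsum_zero_finite :
  exists s : seq I, forall i, i \notin s -> (0 : V i) = 0.
Proof. by exists [::]. Qed.
Definition dsum_zero := Dsum dsum_zero_finite.

Lemma dsum_opp_finite (x : dsum) :
  exists s : seq I, forall i, i \notin s -> - x i = 0.
Proof. by case: (dsum_finite x) => s xs; exists s => i /xs ->; rewrite oppr0. Qed.
Definition dsum_opp x := Dsum (dsum_opp_finite x).

Lemma dsum_add_finite (x y : dsum) :
  exists s : seq I, forall i, i \notin s -> x i + y i = 0.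
Proof.
case: (dsum_finite x) (dsum_finite y) => [s xs] [t yt].
exists (s ++ t) => i; rewrite mem_cat negb_or => /andP[/xs -> /yt ->].
by rewrite addr0.
Qed.
Definition dsum_add x y := Dsum (dsum_add_finite x y).

Lemma dsum_scale_finite a (x : dsum) :
  exists s : seq I, forall i, i \notin s -> a *: x i = 0.
Proof. by case: (dsum_finite x) => s xs; exists s => i /xs ->; rewrite scaler0. Qed.
Definition dsum_scale a x := Dsum (dsum_scale_finite a x).

Lemma dsum_addA : associative dsum_add.
Proof. by move=> x y z; apply: dsumP => i /=; rewrite addrA. Qed.
Lemma dsum_addC : commutative dsum_add.
Proof. by move=> x y; apply: dsumP => i /=; rewrite addrC. Qed.
Lemma dsum_add0 : left_id dsum_zero dsum_add.
Proof. by move=> x; apply: dsumP => i /=; rewrite add0r. Qed.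
Lemma dsum_addN : left_inverse dsum_zero dsum_opp dsum_add.
Proof. by move=> x; apply: dsumP => i /=; rewrite addNr. Qed.

HB.instance Definition _ :=
  GRing.isZmodule.Build dsum dsum_addA dsum_addC dsum_add0 dsum_addN.

Lemma dsum_scaleA a b x : dsum_scale a (dsum_scale b x) = dsum_scale (a * b) x.
Proof. by apply: dsumP => i /=; rewrite scalerA. Qed.
Lemma dsum_scale1 : left_id 1 dsum_scale.
Proof. by move=> x; apply: dsumP => i /=; rewrite scale1r. Qed.
Lemma dsum_scaleDr : right_distributive dsum_scale +%R.
Proof. by move=> a x y; apply: dsumP => i /=; rewrite scalerDr. Qed.
Lemma dsum_scaleDl x : {morph dsum_scale^~ x : a b / a + b}.
Proof. by move=> a b; apply: dsumP => i /=; rewrite scalerDl. Qed.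

HB.instance Definition _ := GRing.Zmodule_isLmodule.Build A dsum
  dsum_scaleA dsum_scale1 dsum_scaleDr dsum_scaleDl.

Lemma dsumDE (x y : dsum) i : (x + y) i = x i + y i. Proof. by []. Qed.
Lemma dsumZE a (x : dsum) i : (a *: x) i = a *: x i. Proof. by []. Qed.
Lemma dsum0E i : (0 : dsum) i = 0. Proof. by []. Qed.

Lemma dsum_in_finite i (v : V i) :
  exists s : seq I, forall j, j \notin s -> dfwith (fun k => 0 : V k) v j = 0.
Proof.
by exists [:: i] => j; rewrite inE eq_sym => ij; rewrite dfwith_out.
Qed.
Definition dsum_in i (v : V i) : dsum := Dsum (dsum_in_finite v).

End DirectSum.

Definition free_module (A : comNzRingType) (T : choiceType) : lmodType A :=
  dsum (fun _ : T => A^o : lmodType A).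

Definition free_gen (A : comNzRingType) (T : choiceType) (t : T) :
  free_module A T := dsum_in (V := fun=> A^o) (i := t) (1 : A).

Section FreeLift.
Variables (A : comNzRingType) (T : choiceType) (W : lmodType A) (g : T -> W).

Definition free_lift (u : free_module A T) : W :=
  \sum_(t \in [set: T]) (u t : A) *: g t.

Lemma free_liftE (u : free_module A T) (s : seq T) : uniq s ->
  (forall t, t \notin s -> u t = 0) ->
  free_lift u = \sum_(t <- s) (u t : A) *: g t.
Proof.
move=> us sP; rewrite fsbig_seq //; apply/esym/fsbig_widen => //.
move=> t /= [_ /negP ts].
by rewrite (sP t) // scale0r.
Qed.

Lemma free_lift_linear : linear free_lift.
Proof.
move=> a u v; case: (dsum_finite u) (dsum_finite v) => [s us] [t vt].
pose r := undup (s ++ t); have ur : uniq r by exact: undup_uniq.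
have [usr vsr] : (forall i, i \notin r -> u i = 0) /\
                 (forall i, i \notin r -> v i = 0).
  split=> i; rewrite mem_undup mem_cat negb_or => /andP[is_ it_].
    exact: us.
  exact: vt.
rewrite !(free_liftE ur) //; last first.
  by move=> i ir; rewrite dsumDE dsumZE usr // vsr // scaler0 addr0.
rewrite scaler_sumr -big_split /=; apply: eq_bigr => i _.
by rewrite scalerA -scalerDl.
Qed.

HB.instance Definition _ := GRing.isLinear.Build A (free_module A T) W _
  free_lift free_lift_linear.

Lemma free_lift_gen t : free_lift (free_gen A t) = g t.
Proof.
rewrite (@free_liftE _ [:: t]) //; last first.
  by move=> i; rewrite inE eq_sym => ti; rewrite /free_gen /= dfwith_out.
by rewrite big_seq1 /= dfwith_in scale1r.
Qed.

End FreeLift.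

Section FreeExt.
Variables (A : comNzRingType) (T : choiceType) (W : lmodType A).

Lemma free_lift_uniq (f : {linear free_module A T -> W}) u :
  f u = free_lift (fun t => f (free_gen A t)) u.
Proof.
case: (dsum_finite u) => s0 us0; pose s := undup s0.
have us : forall t, t \notin s -> u t = 0.
  by move=> t; rewrite mem_undup; exact: us0.
rewrite (free_liftE _ (undup_uniq s0) us).
suff {1}-> : u = \sum_(t <- s) (u t : A) *: free_gen A t.
  by rewrite linear_sum; apply: eq_bigr => t _; rewrite linearZ.
apply: dsumP => i.
have sumE (r : seq T) (F : T -> free_module A T) :
    (\sum_(t <- r) F t : free_module A T) i = \sum_(t <- r) (F t i : A).
  elim: r => [|t r IHr]; first by rewrite !big_nil.
  by rewrite !big_cons dsumDE IHr.
rewrite sumE; have [si|si] := boolP (i \in s); last first.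
  rewrite us // big_seq big1 // => t ts; rewrite dsumZE /= dfwith_out.
    by rewrite scaler0.
  by apply: contraNneq si => <-.
rewrite (bigD1_seq i) ?undup_uniq //= dfwith_in big1 ?addr0.
  by rewrite /GRing.scale /= mulr1.
by move=> t ti; rewrite dfwith_out // scaler0.
Qed.

End FreeExt.

Section Tensor.
Variables (A : comNzRingType) (V W : lmodType A).

Local Notation "[ x , y ]" := (free_gen A (x : V, y : W)).

Inductive tensor_rel : free_module A (V * W)%type -> Prop :=
| TensorDl x x' y : tensor_rel ([x + x', y] - ([x, y] + [x', y]))
| TensorDr x y y' : tensor_rel ([x, y + y'] - ([x, y] + [x, y']))
| TensorZl a x y : tensor_rel ([a *: x, y] - a *: [x, y])
| TensorZr a x y : tensor_rel ([x, a *: y] - a *: [x, y]).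

Definition tensor : lmodType A := modquot (span tensor_rel).

Definition pure_tensor (x : V) (y : W) : tensor := modquot_pi _ [x, y].

End Tensor.

Section TensorTheory.
Variables (A : comNzRingType) (V W P : lmodType A).

Lemma pure_tensorDl (x x' : V) (y : W) :
  pure_tensor (x + x') y = pure_tensor x y + pure_tensor x' y.
Proof.
rewrite /pure_tensor -modquot_piD.
by apply/modquot_pi_eq; apply: sub_span; constructor.
Qed.

Lemma pure_tensorDr (x : V) (y y' : W) :
  pure_tensor x (y + y') = pure_tensor x y + pure_tensor x y'.
Proof.
rewrite /pure_tensor -modquot_piD.
by apply/modquot_pi_eq; apply: sub_span; constructor.
Qed.

Lemma pure_tensorZl a (x : V) (y : W) :
  pure_tensor (a *: x) y = a *: pure_tensor x y.
Proof.
rewrite /pure_tensor -linearZ.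
by apply/modquot_pi_eq; apply: sub_span; constructor.
Qed.

Lemma pure_tensorZr a (x : V) (y : W) :
  pure_tensor x (a *: y) = a *: pure_tensor x y.
Proof.
rewrite /pure_tensor -linearZ.
by apply/modquot_pi_eq; apply: sub_span; constructor.
Qed.

Lemma tensor_ext (f g : {linear tensor V W -> P}) :
  (forall x y, f (pure_tensor x y) = g (pure_tensor x y)) -> f =1 g.
Proof.
move=> fg u; rewrite -[u]modquot_reprK; set v := modquot_repr u.
pose pi := @modquot_pi A _ (span (@tensor_rel A V W)).
transitivity ((f \o pi) v) => //; transitivity ((g \o pi) v) => //.
rewrite free_lift_uniq [RHS]free_lift_uniq; congr free_lift.
by apply/funext => -[x y]; exact: fg.
Qed.

Section Lift.
Variable b : V -> W -> P.

Definition bilinear_map : Prop :=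
  (forall y, linear (b^~ y)) /\ (forall x, linear (b x)).

Lemma tensor_lift_subproof : bilinear_map ->
  {subset span (@tensor_rel A V W) <= ker (free_lift (A := A) (uncurry b))}.
Proof.
move=> [bl br]; apply: span_sub => z; rewrite /= unfold_in => -[].
- move=> x x' y; rewrite linearB linearD /= !free_lift_gen /=.
  by have := bl y 1 x x'; rewrite !scale1r => ->; rewrite subrr.
- move=> x y y'; rewrite linearB linearD /= !free_lift_gen /=.
  by have := br x 1 y y'; rewrite !scale1r => ->; rewrite subrr.
- move=> a x y; rewrite linearB linearZ /= !free_lift_gen /=.
  have b0 : b 0 y = 0.
    by have := bl y (-1) 0 0; rewrite scaler0 addr0 scaleN1r addNr.
  by have := bl y a x 0; rewrite !addr0 b0 addr0 => ->; rewrite subrr.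
- move=> a x y; rewrite linearB linearZ /= !free_lift_gen /=.
  have b0 : b x 0 = 0.
    by have := br x (-1) 0 0; rewrite scaler0 addr0 scaleN1r addNr.
  by have := br x a y 0; rewrite !addr0 b0 addr0 => ->; rewrite subrr.
Qed.

Definition tensor_lift (bP : bilinear_map) : {linear tensor V W -> P} :=
  modquot_lift (tensor_lift_subproof bP).

Lemma tensor_lift_pure (bP : bilinear_map) x y :
  tensor_lift bP (pure_tensor x y) = b x y.
Proof. exact: etrans (modquot_lift_pi _ _) (free_lift_gen _ _). Qed.

End Lift.
End TensorTheory.

Section TensorMap.
Variables (A : comNzRingType) (V V' W : lmodType A) (f : {linear V -> V'}).

Lemma tensor_map_bilinear :
  bilinear_map (fun (x : V) (y : W) => pure_tensor (f x) y).
Proof.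
split=> [y a x x'|x a y y'].
  by rewrite linearP pure_tensorDl pure_tensorZl.
by rewrite pure_tensorDr pure_tensorZr.
Qed.

(* the map f (x) id_W *)
Definition tensor_map : {linear tensor V W -> tensor V' W} :=
  tensor_lift tensor_map_bilinear.

Lemma tensor_map_pure x y : tensor_map (pure_tensor x y) = pure_tensor (f x) y.
Proof. exact: tensor_lift_pure. Qed.

End TensorMap.

Section Complexes.
Variable A : comNzRingType.

(* Cochain complexes; to avoid transport along equations between degrees, the *)
(* differential is a family indexed by pairs of degrees, of which only the    *)
(* diff i (i + 1) may be nonzero.                                             *)
Record complex := Complex {
  obj :> int -> lmodType A;
  diff : forall i j, {linear obj i -> obj j};
  diff_shape : forall i j x, i + 1 != j -> diff i j x = 0;
  diff_diff : forall i j k x, diff j k (diff i j x) = 0 }.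

Definition cycles (X : complex) (i : int) : submodClosed (X i) :=
  ker (diff X i (i + 1)).

Definition boundaries (X : complex) (i : int) : submodClosed (X i) :=
  im (diff X (i - 1) i).

(* H^i(X) = ker d^i / im d^(i-1) *)
Definition cohomology (X : complex) (i : int) : lmodType A :=
  modquot (preim_submod (val : submod (cycles X i) -> X i) (boundaries X i)).

Definition total_cohomology (X : complex) : lmodType A := dsum (cohomology X).

Section TensorComplex.
Variables (X : complex) (N : lmodType A).

Lemma tensor_complex_shape i j (u : tensor (X i) N) :
  i + 1 != j -> tensor_map N (diff X i j) u = 0.
Proof.
move=> ij; pose z : {linear tensor (X i) N -> tensor (X j) N} := \0.
rewrite (tensor_ext (g := z)) // => x y.
apply: etrans (tensor_map_pure _ _ _) _; rewrite diff_shape //=.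
by have := pure_tensorZl 0 (0 : X j) y; rewrite !scale0r.
Qed.

Lemma tensor_complex_diff i j k (u : tensor (X i) N) :
  tensor_map N (diff X j k) (tensor_map N (diff X i j) u) = 0.
Proof.
pose z : {linear tensor (X i) N -> tensor (X k) N} := \0.
transitivity ((tensor_map N (diff X j k) \o tensor_map N (diff X i j)) u) => //.
rewrite (tensor_ext (g := z)) // => x y.
transitivity (tensor_map N (diff X j k) (pure_tensor (diff X i j x) y)).
  by congr (tensor_map _ _ _); exact: tensor_map_pure.
apply: etrans (tensor_map_pure _ _ _) _; rewrite diff_diff /=.
by have := pure_tensorZl 0 (0 : X k) y; rewrite !scale0r.
Qed.

Definition tensor_complex : complex :=
  Complex tensor_complex_shape tensor_complex_diff.

End TensorComplex.

Definition zero_complex : complex :=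
  @Complex (fun=> 'rV[A]_0) (fun i j => \0) (fun i j x _ => erefl)
    (fun i j k x => erefl).

Record cochain_map (X Y : complex) := CochainMap {
  cmap :> forall i, {linear X i -> Y i};
  cmap_diff : forall i j x, cmap j (diff X i j x) = diff Y i j (cmap i x) }.

Definition homotopic (X Y : complex) (f g : forall i, X i -> Y i) : Prop :=
  exists h : forall i j, {linear X i -> Y j}, forall i (x : X i),
    f i x - g i x = diff Y (i - 1) i (h i (i - 1) x)
                    + h (i + 1) i (diff X i (i + 1) x).

(* isomorphism in the homotopy category *)
Definition homotopy_equivalent (X Y : complex) : Prop :=
  exists (f : cochain_map X Y) (g : cochain_map Y X),
    homotopic (fun i x => g i (f i x)) (fun i (x : X i) => x) /\
    homotopic (fun i y => f i (g i y)) (fun i (y : Y i) => y).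

Definition projective (P : lmodType A) : Prop :=
  forall (V W : lmodType A) (p : {linear V -> W}) (f : {linear P -> W}),
    (forall w, exists v, p v = w) ->
    exists g : {linear P -> V}, forall x, p (g x) = f x.

Definition bounded (X : complex) : Prop :=
  exists n : nat, forall (i : int) (x : X i), (n < `|i|)%N -> x = 0.

Definition in_Kb_proj (X : complex) : Prop :=
  bounded X /\ forall i, fg_module (X i) /\ projective (X i).

End Complexes.

Section Ideals.
Variable A : comNzRingType.

Definition noetherian : Prop :=
  forall J : {pred A^o}, submod_closed J -> fg_submod J.

(* [idealr_closed] includes properness *)
Definition prime_ideal (P : {pred A}) : Prop :=
  idealr_closed P /\ prime_idealr_closed P.

Definition maximal_ideal (m : {pred A}) : Prop :=
  idealr_closed m /\
  forall J : {pred A}, idealr_closed J -> {subset m <= J} -> J =i m.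

Definition local_ring (m : {pred A}) : Prop :=
  maximal_ideal m /\ forall m' : {pred A}, maximal_ideal m' -> m' =i m.

Definition primary_ideal (Q : {pred A}) : Prop :=
  idealr_closed Q /\
  forall a b, a * b \in Q -> a \in Q \/ exists n, b ^+ n \in Q.

Definition m_primary (m Q : {pred A}) : Prop :=
  primary_ideal Q /\ forall a, a \in m <-> exists n, a ^+ n \in Q.

Definition ideal_pow (J : {pred A}) (n : nat) : {pred A} :=
  iter n (@smul A A^o J) predT.

End Ideals.

(* Extended numbers are taken over rat, the coefficients of the polynomials    *)
(* below. The supremum of the empty set is -oo; in particular the zero module  *)
(* has dimension -oo and the zero polynomial has degree -oo.                   *)
Definition sup_nat (P : set nat) : \bar rat :=
  ereal_sup [set (k%:R)%:E | k in P].

Section Invariants.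
Variables (A : comNzRingType) (N : lmodType A).

Definition strictly_increasing (T : Type) (k : nat) (c : nat -> {pred T}) :=
  forall i, (i < k)%N ->
    {subset c i <= c i.+1} /\ exists2 x, x \in c i.+1 & x \notin c i.

Definition length : \bar rat := sup_nat [set k | exists c : nat -> {pred N},
  (forall i, (i <= k)%N -> submod_closed (c i)) /\ strictly_increasing k c].

(* dim (A / Ann N), by chains of primes that contain Ann N *)
Definition krull_dim : \bar rat := sup_nat [set k | exists c : nat -> {pred A},
  (forall i, (i <= k)%N ->
     prime_ideal (c i) /\ {subset annihilator N <= c i}) /\
  strictly_increasing k c].

End Invariants.

Definition eventually_poly (f : nat -> \bar rat) : set {poly rat} :=
  [set p | exists n0 : nat, forall n, (n0 <= n)%N -> f n = (p.[n%:R])%:E].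

Definition poly_degree (p : {poly rat}) : \bar rat :=
  if p == 0 then -oo%E else ((size p).-1%:R)%:E.

(* -oo, by convention, if f is not of polynomial type *)
Definition poly_type_degree (f : nat -> \bar rat) : \bar rat :=
  poly_degree (xget 0 (eventually_poly f)).

Section Psi.
Variables (A : comNzRingType) (I : {pred A}) (M : lmodType A) (X : complex A).

Definition mod_pow (n : nat) : lmodType A :=
  modquot (smul (ideal_pow I n) (predT : {pred M})).

(* A sum of infinite support would be 0 here, but if X is bounded then only    *)
(* finitely many of the lengths are nonzero.                                   *)
Definition psi (n : nat) : \bar rat :=
  (\sum_(i \in [set: int])
     length (cohomology (tensor_complex X (mod_pow n)) i))%E.

Definition s_inv : \bar rat := poly_type_degree psi.

End Psi.

(* Main.v *)
Require Import Defs.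
From HB Require Import structures.
From mathcomp Require Import all_boot all_order all_algebra.
From mathcomp Require Import boolp classical_sets constructive_ereal ereal.
From mathcomp Require Import fsbigop ring lra zify.

Set Implicit Arguments.
Unset Strict Implicit.
Unset Printing Implicit Defensive.
Import Order.TTheory GRing.Theory Num.Theory.
Local Open Scope ring_scope.

(** Write [C = X (x) M], with boundaries [B_i], cycles [Z_i] and cohomology
[H_i = Z_i / B_i], and [chi_N (n)] for the length of [N / I ^ n N]. Counting
lengths gives
  [l (H^i (C / I ^ n C)) = chi_(C_i / B_i) + chi_(C_(i+1) / B_(i+1)) - chi_(C_(i+1))]
([coh_len_chi]), so [psi] is of polynomial type because Hilbert-Samuel
functions are ([chi_poly]). By the dimension theorem ([growsP]) the degree of
[chi_N] is [dim N], and it remains to find the degree of [psi].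

The length of [H^i (C / I ^ n C)] splits into a part that comes from [H_i] and a
defect [D_(i+1) (n)], the length of [(B_(i+1) :&: I ^ n C_(i+1)) / I ^ n B_(i+1)].
By the Artin-Rees lemma the first part lies between a shift of [chi_(H_i)] and
[chi_(H_i)], and the defect is at most a difference
[chi_(B_(i+1)) (n) - chi_(B_(i+1)) (n - c)], whose degree is less than [dim M].
This gives the upper bound, and [dim H_i <= deg psi].

For the lower bound [dim M - 1 <= deg psi], take the largest degree [j] in which
[X] itself has cohomology. Above [j] the complex [X] splits, so the cycles of
[X_j] are a direct summand, and there is a functional [X_j -> A] that maps
boundaries into the maximal ideal [m] and some cycle to a unit
([cycle_not_boundary], [cycle_functional]). Tensored with [M] it maps the cycles
of [C_j] onto [M] and [B_j] into [m M]. Hence it maps the quotient that defines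
[D_j (n)] to [I ^ n M / m I ^ n M], with a cokernel of length at most
[chi_(H_j) (n + 1)] ([defect_ge]). The length of [I ^ n M / m I ^ n M] is, up to
a constant factor, at least that of [I ^ n M / I ^ (n+1) M]
([len_primary_le]), which has degree [dim M - 1].

All modules that occur are subquotients [U / V] of a fixed Noetherian module,
and the theory is developed for pairs [V <= U] of submodules. The Noetherian
property of the Rees module ([rees_noetherian]) is proved by Hilbert's basis
argument, directly for families of submodules; it gives both the Artin-Rees
lemma and the Hilbert-Serre theorem ([hilbert_serre]). *)

(** * Submodules *)

(** Submodules as [Prop]-valued predicates, so that membership in a sum or an
image is definitionally an existential statement. *)
Record sub (A : comNzRingType) (V : lmodType A) := MkSub {
  car :> V -> Prop;
  sub_closed : car 0 /\ forall a x y, car x -> car y -> car (a *: x + y) }.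

Definition incl (A : comNzRingType) (V : lmodType A) (U W : sub V) : Prop :=
  forall x, U x -> W x.
Notation "U <=s W" := (incl U W) (at level 70, no associativity).

Section SubTheory.
Variables (A : comNzRingType).
Section Basic.
Variable V : lmodType A.
Implicit Types (U W X Y : sub V) (a b : A) (x y : V).

Lemma sub0 U : U 0. Proof. by case: U => ? []. Qed.
Lemma subP U a x y : U x -> U y -> U (a *: x + y).
Proof. by case: U => ? [] ? h; apply: h. Qed.
Lemma subD U x y : U x -> U y -> U (x + y).
Proof. by move=> ux uy; rewrite -[x]scale1r; apply: subP. Qed.
Lemma subZ U a x : U x -> U (a *: x).
Proof. by move=> ux; rewrite -[_ *: _]addr0; apply: subP => //; apply: sub0. Qed.
Lemma subN U x : U x -> U (- x).
Proof. by rewrite -scaleN1r; apply: subZ. Qed.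
Lemma subB U x y : U x -> U y -> U (x - y).
Proof. by move=> ux uy; apply: subD => //; apply: subN. Qed.
Lemma subDl U x y : U x -> U (x + y) -> U y.
Proof. by move=> ux uxy; rewrite -[y](addKr x); apply: subD => //; apply: subN. Qed.

Lemma incl_refl U : U <=s U. Proof. by []. Qed.
Lemma incl_trans W U X : U <=s W -> W <=s X -> U <=s X.
Proof. by move=> h h' x /h /h'. Qed.

Lemma incl_mono (c : nat -> sub V) : (forall i, c i <=s c i.+1) ->
  forall i j, (i <= j)%N -> c i <=s c j.
Proof.
move=> cinc i; elim=> [|j IH]; first by rewrite leqn0 => /eqP ->.
by rewrite leq_eqVlt => /orP[/eqP -> //|/IH h]; apply: incl_trans h _.
Qed.

Program Definition zeroS : sub V := @MkSub A V (fun x => x = 0) _.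
Next Obligation.
by split=> // a x y -> ->; rewrite scaler0 addr0.
Qed.

Program Definition fullS : sub V := @MkSub A V (fun x => True) _.
Next Obligation. by []. Qed.

Program Definition addS U W : sub V :=
  @MkSub A V (fun x => exists u w, [/\ U u, W w & x = u + w]) _.
Next Obligation.
move=> U W; split; first by exists 0, 0; split; rewrite ?addr0 //; apply: sub0.
move=> a _ _ [u [w [Uu Ww ->]]] [u' [w' [Uu' Ww' ->]]].
exists (a *: u + u'), (a *: w + w'); split; try exact: subP.
by rewrite scalerDr addrACA.
Qed.

Program Definition capS U W : sub V := @MkSub A V (fun x => U x /\ W x) _.
Next Obligation.
move=> U W; split; first by split; apply: sub0.
by move=> a x y [? ?] [? ?]; split; apply: subP.
Qed.

Program Definition mulS b U : sub V := @MkSub A V (fun x => exists2 u, U u & x = b *: u) _.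
Next Obligation.
move=> b U; split; first by exists 0; [apply: sub0 | rewrite scaler0].
move=> a _ _ [u Uu ->] [w Uw ->]; exists (a *: u + w); first exact: subP.
by rewrite scalerDr !scalerA mulrC.
Qed.

(** The kernel of multiplication by [b] from [U] to the quotient by [W]. *)
Program Definition divS b W U : sub V := @MkSub A V (fun x => U x /\ W (b *: x)) _.
Next Obligation.
move=> b W U; split; first by split; rewrite ?scaler0; apply: sub0.
move=> a x y [Ux Wx] [Uy Wy]; split; first exact: subP.
by rewrite scalerDr scalerA mulrC -scalerA; apply: subP.
Qed.

(** The ideal [(W : U)]. *)
Program Definition colS W U : sub (A^o) :=
  @MkSub A A^o (fun a : A => forall u, U u -> W (a *: u)) _.
Next Obligation.
move=> W U; split; first by move=> u _; rewrite scale0r; apply: sub0.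
by move=> a b c Wb Wc u Uu; rewrite scalerDl -scalerA; apply: subP; auto.
Qed.

End Basic.
Variable V : lmodType A.
Implicit Types (a b : A) (g : V).

(** The module structure of [A^o] hides the ring operations of [A]; the next
lemmas restate the closure properties of ideals for the latter. *)
Lemma id0 (P : sub A^o) : P (0 : A). Proof. exact: (sub0 P). Qed.
Lemma idD (P : sub A^o) a b : P a -> P b -> P (a + b). Proof. exact: subD. Qed.
Lemma idM (P : sub A^o) a b : P b -> P (a * b). Proof. exact: subZ. Qed.
Lemma idMr (P : sub A^o) a b : P a -> P (a * b).
Proof. by rewrite mulrC; apply: idM. Qed.

Program Definition lineS (P : sub A^o) (g : V) : sub V :=
  @MkSub A V (fun x => exists2 p : A, P p & x = p *: g) _.
Next Obligation.
move=> P g; split; first by exists 0; rewrite ?scale0r //; apply: id0.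
move=> a _ _ [p Pp ->] [q Pq ->]; exists (a * p + q).
  by apply: idD => //; apply: idM.
by rewrite scalerDl scalerA.
Qed.
End SubTheory.

Section Lattice.
Variables (A : comNzRingType) (V W : lmodType A).
Implicit Types (U X Y Z : sub V) (f : {linear V -> W}).

Program Definition imS f U : sub W :=
  @MkSub A W (fun y => exists2 u, U u & y = f u) _.
Next Obligation.
move=> f U; split; first by exists 0; [apply: sub0 | rewrite linear0].
by move=> a _ _ [u Uu ->] [v Uv ->]; exists (a *: u + v); [apply: subP | rewrite linearP].
Qed.

Program Definition preS f (Y : sub W) : sub V := @MkSub A V (fun x => Y (f x)) _.
Next Obligation.
move=> f Y; split; first by rewrite linear0; apply: sub0.
by move=> a x y Yx Yy; rewrite linearP; apply: subP.
Qed.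

Lemma addS_l X Y : X <=s addS X Y.
Proof. by move=> x Xx; exists x, 0; split; rewrite ?addr0 //; apply: sub0. Qed.
Lemma addS_r X Y : Y <=s addS X Y.
Proof. by move=> x Xx; exists 0, x; split; rewrite ?add0r //; apply: sub0. Qed.
Lemma addS_sub X Y Z : X <=s Z -> Y <=s Z -> addS X Y <=s Z.
Proof. by move=> XZ YZ _ [x [y [/XZ Zx /YZ Zy ->]]]; apply: subD. Qed.
Lemma addSS X Y X' Y' : X <=s X' -> Y <=s Y' -> addS X Y <=s addS X' Y'.
Proof. by move=> h h' _ [x [y [/h ? /h' ? ->]]]; exists x, y. Qed.
Lemma capS_l X Y : capS X Y <=s X. Proof. by move=> x []. Qed.
Lemma capS_r X Y : capS X Y <=s Y. Proof. by move=> x []. Qed.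
Lemma zeroS_sub X : zeroS V <=s X.
Proof. by move=> _ ->; apply: sub0. Qed.
Lemma mulS_sub b X : mulS b X <=s X.
Proof. by move=> _ [x Xx ->]; apply: subZ. Qed.
Lemma lineS_gen g : lineS (fullS A^o) g (g : V).
Proof. by exists 1; rewrite ?scale1r. Qed.
Lemma lineS_sub P (g : V) X : X g -> lineS P g <=s X.
Proof. by move=> Xg _ [p _ ->]; apply: subZ. Qed.
End Lattice.

#[global] Hint Resolve incl_refl sub0 addS_l addS_r zeroS_sub : core.

(** * Noetherian modules *)

(** Most finiteness arguments below pick a maximal submodule with some property,
so Noetherian modules are given by the maximum condition. *)
Definition max_cond (A : comNzRingType) (N : lmodType A) : Prop :=
  forall F : sub N -> Prop, (exists U, F U) ->
  exists2 U, F U & forall W, F W -> U <=s W -> W <=s U.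

Section MaxCond.
Variables (A : comNzRingType) (N : lmodType A).
Implicit Types (U V W X Y : sub N).

(** The maximum condition for [U / V]. *)
Definition max_between V U : Prop :=
  forall F : sub N -> Prop, (exists W, F W) ->
  (forall W, F W -> V <=s W /\ W <=s U) ->
  exists2 X, F X & forall W, F W -> X <=s W -> W <=s X.

(** The maximum condition passes to extensions: maximize first the image in
[U / W], then the intersection with [W]. *)
Lemma max_betweenE V W U :
  V <=s W -> W <=s U -> max_between V W -> max_between W U -> max_between V U.
Proof.
move=> VW WU maxV maxU F [X FX] Fb.
have [|D|_ [c0 Fc0 ->] c0max] := maxU (fun D => exists2 c, F c & D = addS c W).
- by exists (addS X W), X.
- case=> c Fc ->; split; first exact: addS_r.
  by apply: addS_sub => //; case: (Fb c Fc).
have [||_ [c1 [Fc1 c01 ->]] c1max] := maxV (fun E => exists c,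
  [/\ F c, addS c0 W <=s addS c W & E = capS c W]).
- by exists (capS c0 W), c0.
- move=> _ [c [Fc _ ->]]; split; last exact: capS_r.
  by move=> x Vx; split; [case: (Fb c Fc) => h _; apply: h | apply: VW].
exists c1 => // c Fc c1c x cx.
have c0c : addS c0 W <=s addS c W.
  by apply: incl_trans c01 _; apply: addSS.
have [u [w [c1u Ww xE]]] : addS c1 W x.
  apply: c01; apply: (c0max (addS c W)) => //; first by exists c.
  exact: addS_l.
rewrite xE; apply: subD => //.
have [] : capS c1 W w => //; apply: (c1max (capS c W)); first by exists c.
- by move=> y [c1y Wy]; split=> //; apply: c1c.
by split=> //; apply: (@subDl _ _ _ u); [apply: c1c | rewrite -xE].
Qed.

(** [(V + A g) / V] is a quotient of [A]. *)
Lemma max_between_line V g :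
  max_cond A^o -> max_between V (addS V (lineS (fullS A^o) g)).
Proof.
move=> maxA F [X FX] Fb.
have [|_ [c Fc ->] cmax] := maxA (fun D => exists2 c, F c & D = colS c (lineS (fullS A^o) g)).
  by exists (colS X (lineS (fullS A^o) g)), X.
exists c => // d Fd cd x dx.
have [Vd _] := Fb d Fd; have [Vc _] := Fb c Fc.
have [_ dU] := Fb d Fd; have [v [_ [Vv [a _ ->] xE]]] := dU x dx.
rewrite xE; apply: subD; first exact: Vc.
have : colS c (lineS (fullS A^o) g) a.
  apply: (cmax (colS d (lineS (fullS A^o) g))); first by exists d.
    by move=> b cb u gu; apply: cd; apply: cb.
  have dag : d (a *: g) by apply: (@subDl _ _ _ v); [apply: Vd | rewrite -xE].
  by move=> _ [b _ ->]; rewrite scalerA mulrC -scalerA; apply: subZ.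
by apply; apply: lineS_gen.
Qed.

Definition genS (s : seq N) : sub N :=
  foldr (fun g U => addS U (lineS (fullS A^o) g)) (zeroS N) s.

Lemma mem_genS s g : g \in s -> genS s g.
Proof.
elim: s => // h s IH; rewrite inE => /orP[/eqP ->|/IH gs].
  by apply: addS_r; apply: lineS_gen.
exact: addS_l.
Qed.

Lemma genS_sub s X : (forall g, g \in s -> X g) -> genS s <=s X.
Proof.
elim: s => [|h s IH] sX; first exact: zeroS_sub.
apply: addS_sub; first by apply: IH => g gs; apply: sX; rewrite inE gs orbT.
by apply: lineS_sub; apply: sX; rewrite inE eqxx.
Qed.

(** [of_pred] and [to_pred] pass between [sub] and boolean predicates. *)
Definition of_pred (P : {pred N}) (h : submod_closed P) : sub N :=
  @MkSub A N (fun x => x \in P) (conj h.1 (fun a x y Px Py => h.2 a x y Px Py)).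

Definition to_pred (U : sub N) : {pred N} := fun x => `[< U x >].

Lemma to_predE U x : x \in to_pred U <-> U x.
Proof. by split=> /asboolP. Qed.

Lemma to_pred_closed U : submod_closed (to_pred U).
Proof.
split=> [|a x y /asboolP Ux /asboolP Uy]; apply/asboolP; first exact: sub0.
exact: subP.
Qed.

Lemma span_genS (s : seq N) x : x \in Defs.span [set` s]%classic <-> genS s x.
Proof.
split=> [/asboolP|].
  move=> /(_ (to_pred (genS s)) (to_pred_closed _)) h; apply/to_predE/h.
  by move=> g /= gs; apply/to_predE/mem_genS.
move=> sx; apply/asboolP => P Pc sP.
by apply: (@genS_sub s (of_pred Pc)) sx => g gs; apply: sP.
Qed.

Lemma fg_gen : fg_module N -> exists s, forall x, genS s x.
Proof. by case=> s sN; exists s => x; apply/span_genS; rewrite -sN. Qed.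

Lemma gen_max_cond s : max_cond A^o -> (forall x, genS s x) -> max_cond N.
Proof.
move=> maxA sN F Fex.
suff maxs : max_between (zeroS N) (genS s).
  by apply: maxs => // W _; split=> [|x _]; [exact: zeroS_sub | exact: sN].
elim: s {sN} => [|g s IH].
  move=> G [X GX] Gb; exists X => // W GW _; apply: incl_trans (zeroS_sub _).
  by case: (Gb W GW).
apply: max_betweenE IH _; [exact: zeroS_sub | exact: addS_l | exact: max_between_line].
Qed.

Lemma max_cond_stable (c : nat -> sub N) : max_cond N ->
  (forall i, c i <=s c i.+1) -> exists i0, forall i, (i0 <= i)%N -> c i <=s c i0.
Proof.
move=> maxN cinc.
have [|_ [i0 ->] i0max] := maxN (fun U => exists i, U = c i).
  by exists (c 0), 0%N.
by exists i0 => i i0i; apply: i0max; [exists i | apply: incl_mono].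
Qed.
End MaxCond.

(** Without a maximal member there is a strictly increasing sequence of ideals;
its union is finitely generated, hence equal to one of them. *)
Lemma noetherian_max_cond (A : comNzRingType) : noetherian A -> max_cond A^o.
Proof.
move=> noethA F [U0 FU0]; apply: contrapT => nomax.
have nextP (U : {U | F U}) : exists W : {W | F W},
    sval U <=s sval W /\ ~ sval W <=s sval U.
  case: U => U FU /=; apply: contrapT => noW; apply: nomax; exists U => // W FW UW.
  by apply: contrapT => WU; apply: noW; exists (exist _ W FW).
have [next nextE] := choice nextP.
pose c i := sval (iter i next (exist _ U0 FU0)).
have cS i : c i <=s c i.+1 /\ ~ c i.+1 <=s c i by apply: nextE.
have cmono i j : (i <= j)%N -> c i <=s c j.
  by apply: incl_mono => k; case: (cS k).
have Jc : (exists i, c i (0 : A^o)) /\ forall (a x y : A^o), (exists i, c i x) ->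
    (exists i, c i y) -> exists i, c i (a *: x + y).
  split; first by exists 0%N; apply: sub0.
  move=> a x y [i ix] [j jy]; exists (maxn i j); apply: subP.
    by apply: cmono ix; apply: leq_maxl.
  by apply: cmono jy; apply: leq_maxr.
pose J := @MkSub A A^o (fun x => exists i, c i x) Jc.
have [s sJ] := noethA _ (to_pred_closed J).
have [n sn] : exists n, forall g, g \in s -> c n g.
  have : forall g, g \in s -> J g.
    by move=> g gs; apply/to_predE; rewrite sJ; apply/span_genS/mem_genS.
  elim: s {sJ} => [|g s IH] sJ; first by exists 0%N.
  have [|n nP] := IH; first by move=> h hs; apply: sJ; rewrite inE hs orbT.
  have [|i ig] := sJ g; first by rewrite inE eqxx.
  exists (maxn i n) => h; rewrite inE => /orP[/eqP ->|/nP].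
    by apply: cmono ig; apply: leq_maxl.
  by apply: cmono; apply: leq_maxr.
case: (cS n) => _; apply=> x xn; apply: (genS_sub sn).
by apply/span_genS; rewrite -sJ; apply/to_predE; exists n.+1.
Qed.

(** * Powers of an ideal acting on submodules *)

Section IdealPowers.
Variables (A : comNzRingType).
Section OneModule.
Variable N : lmodType A.
Implicit Types (s : seq A) (U X Y : sub N).

(** The product [J U], for the ideal [J] generated by [s]; an ideal is given by a
list of generators so that one can argue by induction on their number. *)
Definition seqS s U : sub N := foldr (fun b X => addS (mulS b U) X) (zeroS N) s.

Definition powS s n U : sub N := iter n (seqS s) U.

Lemma seqS_mem s b U u : b \in s -> U u -> seqS s U (b *: u).
Proof.
elim: s => // c s IH; rewrite inE => /orP[/eqP ->|/IH h] Uu.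
  by apply: addS_l; exists u.
by apply: addS_r; apply: h.
Qed.

Lemma seqS_sub s U X : (forall b u, b \in s -> U u -> X (b *: u)) -> seqS s U <=s X.
Proof.
elim: s => [|b s IH] h; first exact: zeroS_sub.
apply: addS_sub => [_ [u Uu ->]|]; first by apply: h => //; rewrite inE eqxx.
by apply: IH => c u cs Uu; apply: h => //; rewrite inE cs orbT.
Qed.

Lemma seqSS s U X : U <=s X -> seqS s U <=s seqS s X.
Proof. by move=> UX; apply: seqS_sub => b u bs /UX; apply: seqS_mem. Qed.

Lemma seqS_le s U : seqS s U <=s U.
Proof. by apply: seqS_sub => b u _; apply: subZ. Qed.

Lemma powSS s n U X : U <=s X -> powS s n U <=s powS s n X.
Proof. by move=> UX; elim: n => //= n; apply: seqSS. Qed.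

Lemma powS_le s n U : powS s n U <=s U.
Proof. by elim: n => //= n; apply: incl_trans; apply: seqS_le. Qed.

Lemma powS_addS s n X Y : powS s n (addS X Y) <=s addS (powS s n X) (powS s n Y).
Proof.
elim: n => //= n IH; apply: incl_trans (seqSS IH) _.
apply: seqS_sub => b _ bs [x [y [Xx Yy ->]]]; exists (b *: x), (b *: y).
by rewrite scalerDr; split=> //; apply: seqS_mem.
Qed.

Lemma powS_mulS s n b U : powS s n (mulS b U) <=s mulS b (powS s n U).
Proof.
elim: n => //= n IH; apply: incl_trans (seqSS IH) _.
apply: seqS_sub => c _ cs [u Uu ->]; exists (c *: u); first exact: seqS_mem.
by rewrite !scalerA mulrC.
Qed.

Lemma powS_seqS s t n U : powS s n (seqS t U) <=s seqS t (powS s n U).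
Proof.
elim: n => //= n IH; apply: incl_trans (seqSS IH) _.
apply: seqS_sub => b u bs; elim: t {IH} u => [|c t IHt] u.
  by move=> ->; rewrite scaler0.
case=> _ [w [[v Pv ->] tw ->]]; rewrite scalerDr; apply: subD.
  apply: addS_l; exists (b *: v); first exact: seqS_mem.
  by rewrite !scalerA mulrC.
by apply: addS_r; apply: IHt.
Qed.

End OneModule.

Section Morphism.
Variables (N N' : lmodType A) (f : {linear N -> N'}) (s : seq A).

Lemma seqS_map (U : sub N) (X : sub N') :
  U <=s preS f X -> seqS s U <=s preS f (seqS s X).
Proof.
move=> UX; apply: seqS_sub => b u bs Uu /=; rewrite linearZ.
by apply: seqS_mem => //; apply: UX.
Qed.

Lemma powS_map n (U : sub N) (X : sub N') :
  U <=s preS f X -> powS s n U <=s preS f (powS s n X).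
Proof. by move=> UX; elim: n => //= n; apply: seqS_map. Qed.

Lemma seqS_im (U : sub N) (X : sub N') :
  X <=s imS f U -> seqS s X <=s imS f (seqS s U).
Proof.
move=> XU; apply: seqS_sub => b x bs /XU[u Uu ->].
by exists (b *: u); [apply: seqS_mem | rewrite linearZ].
Qed.

Lemma powS_im n (U : sub N) (X : sub N') :
  X <=s imS f U -> powS s n X <=s imS f (powS s n U).
Proof. by move=> XU; elim: n => //= n; apply: seqS_im. Qed.

End Morphism.
End IdealPowers.

(** * Length of a subquotient *)

Section Length.
Variables (A : comNzRingType).
Section OneModule.
Variable N : lmodType A.
Implicit Types (U V W X Y : sub N).

Definition chain V U (k : nat) : Prop := exists c : nat -> sub N,
  [/\ V <=s c 0%N, c k <=s U &
      forall i, (i < k)%N -> c i <=s c i.+1 /\ ~ c i.+1 <=s c i].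

Definition fin V U : Prop := exists k, forall j, chain V U j -> (j <= k)%N.

(** The length of [U / V], and [0] if that is infinite. *)
Definition len V U : nat :=
  xget 0%N [set k | chain V U k /\ forall j, chain V U j -> (j <= k)%N]%classic.

Lemma chain_le c k : (forall i, (i < k)%N -> c i <=s c i.+1 /\ ~ c i.+1 <=s c i) ->
  forall i j, (i <= j <= k)%N -> c i <=s (c j : sub N).
Proof.
move=> h i; elim=> [|j IH]; first by rewrite leqn0 => /andP[/eqP ->].
rewrite leq_eqVlt => /andP[/orP[/eqP -> //|ij jk]].
by apply: (incl_trans (W := c j)); [apply: IH; rewrite -ltnS ij ltnW | case: (h j)].
Qed.

Lemma chain0 V U : chain V U 0 <-> V <=s U.
Proof. by split=> [[c [h h' _]]|VU]; [apply: incl_trans h h' | exists (fun=> V)]. Qed.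

Lemma chain_incl V U k : chain V U k -> V <=s U.
Proof.
case=> c [h h' /chain_le cle]; apply: incl_trans h _; apply: incl_trans h'.
by apply: cle; rewrite leqnn.
Qed.

Lemma lenP V U : V <=s U -> fin V U ->
  chain V U (len V U) /\ forall j, chain V U j -> (j <= len V U)%N.
Proof.
move=> VU [k kmax]; rewrite /len; case: xgetP => // nolen.
have [n nP nmax] : exists2 n, chain V U n & forall j, chain V U j -> (j <= n)%N.
  elim: k kmax => [|k IH] kmax.
    by exists 0%N => //; apply/chain0.
  have [ck|nck] := pselect (chain V U k.+1); first by exists k.+1.
  apply: IH => j cj; rewrite -ltnS ltn_neqAle kmax // andbT.
  by apply/eqP => jk; apply: nck; rewrite -jk.
by case: (nolen n).
Qed.

Lemma len_junk V U : ~ V <=s U -> fin V U /\ len V U = 0%N.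
Proof.
move=> VU; have nch j : ~ chain V U j by move/chain_incl.
by split; [exists 0%N => j /nch | rewrite /len; case: xgetP => // k _ [/nch]].
Qed.

Lemma len_uniq V U k : chain V U k -> (forall j, chain V U j -> (j <= k)%N) ->
  fin V U /\ len V U = k.
Proof.
move=> ck kmax; have fVU : fin V U by exists k.
have [h h'] := lenP (chain_incl ck) fVU.
by split=> //; apply/eqP; rewrite eqn_leq kmax //= h'.
Qed.

Lemma len_eq0 V U : V <=s U -> fin V U -> len V U = 0%N -> U <=s V.
Proof.
move=> VU fVU l0; apply: contrapT => nUV.
suff c1 : chain V U 1 by have [_ /(_ _ c1)] := lenP VU fVU; rewrite l0.
by exists (fun i => if i is 0%N then V else U); split=> // -[].
Qed.

(** Concatenating chains gives one inequality; for the other a chain from [V] to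
[U] is intersected with [W] and added to [W], and by the modular law each step
stays strict in one of the two. *)
Lemma len_add V W U : V <=s W -> W <=s U -> fin V W -> fin W U ->
  fin V U /\ len V U = (len V W + len W U)%N.
Proof.
move=> VW WU fVW fWU.
have [[c [Vc cW cS]] cmax] := lenP VW fVW.
have [[d [Wd dU dS]] dmax] := lenP WU fWU.
apply: len_uniq.
  exists (fun i => if (i < len V W)%N then c i else d (i - len V W)%N); split.
  - case: ltnP => // l0; apply: incl_trans VW _; apply: incl_trans Wd _.
    by rewrite sub0n.
  - by rewrite ltnNge leq_addr /= addKn.
  move=> i il; case: (ltnP i) => [iV|Vi]; last first.
    rewrite ltnNge (leq_trans Vi (leqnSn _)) /= subSn //; apply: dS.
    by rewrite ltn_subLR.
  case: (ltnP i.+1) => [_|Vi]; first exact: cS.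
  have -> : (i.+1 - len V W = 0)%N by apply/eqP; rewrite subn_eq0.
  have iE : i.+1 = len V W by apply/eqP; rewrite eqn_leq iV Vi.
  have [ci nci] := cS i iV; rewrite iE in ci nci; split.
    by apply: incl_trans ci _; apply: incl_trans cW _.
  by move=> h; apply: nci; apply: incl_trans cW _; apply: incl_trans Wd h.
move=> k [e [Ve eU eS]].
have eW : forall j, (j <= k)%N -> exists2 a, chain V (capS (e j) W) a &
    exists2 b, chain W (addS (e j) W) b & (j <= a + b)%N.
  elim=> [|j IH] jk.
    exists 0%N; first by apply/chain0 => x Vx; split; auto.
    by exists 0%N => //; apply/chain0.
  have [a [c' [Vc' c'W c'S]] [b [d' [Wd' d'W d'S]] jab]] := IH (ltnW jk).
  have [ej nej] := eS j jk.
  pose ext (f : nat -> sub N) (n : nat) (X : sub N) := fun i => if (i <= n)%N then f i else X.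
  have extP V0 f n X Y : V0 <=s f 0%N -> f n <=s Y -> ~ X <=s Y -> Y <=s X ->
      (forall i, (i < n)%N -> f i <=s f i.+1 /\ ~ f i.+1 <=s f i) -> chain V0 X n.+1.
    move=> h0 hn XY YX hS; exists (ext f n X); split; rewrite /ext ?ltnn //.
    move=> i; rewrite ltnS => iln; rewrite iln; case: ltnP => [h|ni]; first exact: hS.
    have -> : i = n by apply/eqP; rewrite eqn_leq iln.
    by split; [apply: incl_trans hn YX | move=> h; apply: XY; apply: incl_trans h hn].
  have [capj|ncapj] := pselect (capS (e j.+1) W <=s capS (e j) W); last first.
    exists a.+1.
      apply: extP Vc' c'W ncapj _ c'S => x [ex Wx]; split=> //; exact: ej.
    exists b; last by rewrite addSn ltnS.
    exists d'; split=> //; apply: incl_trans d'W _; exact: addSS.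
  exists a.
    by exists c'; split=> //; apply: incl_trans c'W _ => x [ex Wx]; split=> //; exact: ej.
  exists b.+1; last by rewrite addnS ltnS.
  apply: extP Wd' d'W _ _ d'S; last exact: addSS.
  move=> add; apply: nej => x ex.
  have [y [w [ey Ww xE]]] : addS (e j) W x by apply: add; apply: addS_l.
  rewrite xE; apply: subD => //; have [] // : capS (e j) W w.
  apply: capj; split=> //; apply: (@subDl _ _ _ y); first exact: ej.
  by rewrite -xE.
have [a ca [b cb kab]] := eW k (leqnn k).
apply: (leq_trans kab); apply: leq_add.
  by apply: cmax; case: ca => f [h1 h2 h3]; exists f; split=> // x /h2 [].
apply: dmax; case: cb => f [h1 h2 h3]; exists f; split=> //.
apply: incl_trans h2 _; apply: addS_sub => //.
Qed.
End OneModule.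

(** All comparisons of lengths come from monotone maps of submodules that reflect
inclusion, as they preserve strict chains. *)
Lemma len_le_map (N N' : lmodType A) (V U : sub N) (V' U' : sub N')
    (Phi : sub N -> sub N') : fin V' U' ->
  (forall W, V <=s W -> W <=s U -> V' <=s Phi W /\ Phi W <=s U') ->
  (forall W X, V <=s W -> W <=s X -> X <=s U ->
     Phi W <=s Phi X /\ (Phi X <=s Phi W -> X <=s W)) ->
  fin V U /\ (len V U <= len V' U')%N.
Proof.
move=> fin' Phib Phim.
have [VU|nVU] := pselect (V <=s U); last first.
  by have [? ->] := len_junk nVU.
have tr k : chain V U k -> chain V' U' k.
  case=> c [Vc cU cS]; have cle := chain_le cS.
  have cb i : (i <= k)%N -> V <=s c i /\ c i <=s U.
    move=> ik; split; first by apply: incl_trans Vc _; apply: cle.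
    by apply: incl_trans cU; apply: cle; rewrite ik leqnn.
  exists (fun i => Phi (c i)); split.
  - by have [|h h'] := cb 0%N; [|case: (Phib _ h h')].
  - by have [|h h'] := cb k; [|case: (Phib _ h h')].
  move=> i ik; have [ci nci] := cS i ik.
  have [||h h'] := Phim (c i) (c i.+1) _ ci.
  - by case: (cb i (ltnW ik)).
  - by case: (cb i.+1 ik).
  by split=> // /h'.
have VU' : V' <=s U' by have [h h'] := Phib _ (@incl_refl _ _ V) VU; apply: incl_trans h h'.
have [_ max'] := lenP VU' fin'.
have fVU : fin V U by exists (len V' U') => j /tr /max'.
by split=> //; have [/tr /max'] := lenP VU fVU.
Qed.

Section Maps.
Variables (N N' : lmodType A) (f : {linear N -> N'}).
Variables (V U : sub N) (V' U' : sub N').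

(** [f] induces an injection [U / V -> U' / V']. *)
Lemma len_inj : V' <=s U' -> fin V' U' -> U <=s preS f U' ->
  (forall u, U u -> V' (f u) -> V u) ->
  fin V U /\ (len V U <= len V' U')%N.
Proof.
move=> VU' fin' UU' inj.
apply: (len_le_map (Phi := fun W => addS (imS f W) V')) => // [W _ WU|W X VW WX XU].
  by split=> //; apply: addS_sub => // _ [u /WU /UU' h ->].
split; first by apply: addSS => // _ [u /WX Xu ->]; exists u.
move=> XW x Xx.
have [_ [v' [[w Ww ->] Vv' xE]]] : addS (imS f W) V' (f x).
  by apply: XW; apply: addS_l; exists x.
rewrite -(subrK w x); apply: subD => //; apply/VW/inj.
  by apply: subB; apply: XU => //; apply: WX.
by rewrite linearB xE [f w + v']addrC addrK.
Qed.

(** [f] induces a surjection [U / V -> U' / V']. *)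
Lemma len_surj : V <=s U -> fin V U -> V <=s preS f V' ->
  U' <=s addS (imS f U) V' ->
  fin V' U' /\ (len V' U' <= len V U)%N.
Proof.
move=> VU finVU VV' UU'.
apply: (len_le_map (Phi := fun W => capS U (preS f W))) => // [W VW WU|W X VW WX XU].
  by split=> [v Vv|]; [split; [apply: VU | apply/VW/VV'] | apply: capS_l].
split; first by move=> u [Uu Wu]; split=> //; apply: WX.
move=> XW x Xx; have [_ [v' [[u Uu ->] Vv' xE]]] := UU' x (XU x Xx).
rewrite xE; apply: subD; last exact: VW.
suff [] : capS U (preS f W) u by [].
apply: XW; split=> //=; apply: (@subDl _ _ _ v'); first by apply/WX/VW.
by rewrite addrC -xE.
Qed.

End Maps.

Lemma len_iso (N N' : lmodType A) (f : {linear N -> N'}) (V U : sub N) (V' U' : sub N') :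
  V <=s U -> V' <=s U' -> fin V U -> U <=s preS f U' -> V <=s preS f V' ->
  (forall u, U u -> V' (f u) -> V u) -> U' <=s addS (imS f U) V' ->
  fin V' U' /\ len V' U' = len V U.
Proof.
move=> VU VU' fVU UU' VV' inj surj.
have [f' le1] := len_surj VU fVU VV' surj.
have [_ le2] := len_inj VU' f' UU' inj.
by split=> //; apply/eqP; rewrite eqn_leq le1 le2.
Qed.

Lemma len_mono (N : lmodType A) (V U V' U' : sub N) :
  V' <=s V -> V <=s U -> U <=s U' -> fin V' U' -> fin V U /\ (len V U <= len V' U')%N.
Proof.
move=> h h' h'' fin'.
apply: (len_le_map (Phi := id)) => // [W VW WU]; split.
  exact: incl_trans h VW.
exact: incl_trans WU h''.
Qed.
End Length.

(** * The Rees module is Noetherian *)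

Section Rees.
Variables (A : comNzRingType) (N : lmodType A).
Hypothesis maxN : max_cond N.
Implicit Types (s : seq A) (U : sub N) (W : nat -> sub N).

(** A homogeneous submodule [\sum_n W n T ^ n] of [N[T]], closed under
multiplication by the elements [b T], [b] in [s], of the Rees algebra. *)
Definition stable s W : Prop := forall b n u, b \in s -> W n u -> W n.+1 (b *: u).

(** [level b s U i n] is [\sum_(j < i | j <= n) b ^ j J ^ (n - j) U], where [J]
is generated by [s]: the forms of degree [n] in [b :: s] that have degree less
than [i] in [b]. *)
Fixpoint level b s U (i n : nat) : sub N :=
  if i is j.+1 then
    addS (level b s U j n)
         (if (j <= n)%N then mulS (b ^+ j) (powS s (n - j) U) else zeroS N)
  else zeroS N.

Lemma level_mono b s U i n : level b s U i n <=s level b s U i.+1 n.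
Proof. exact: addS_l. Qed.

Lemma level_mul b s U i n u :
  level b s U i n u -> level b s U i.+1 n.+1 (b *: u).
Proof.
elim: i u => [|i IH] u; first by move=> ->; rewrite scaler0.
case=> v [w [/IH vl wl ->]]; rewrite scalerDr; apply: subD.
  exact: addS_l.
apply: addS_r; rewrite ltnS subSS; case: ifP wl => [_ [g gU ->]|_ ->].
  by exists g => //; rewrite scalerA exprS.
by rewrite scaler0.
Qed.

Lemma level_stable b s U i : stable s (level b s U i).
Proof.
move=> c n u cs; elim: i u => [|i IH] u; first by move=> ->; rewrite scaler0.
case=> v [w [/IH vl wl ->]]; rewrite scalerDr; apply: subD; first exact: addS_l.
apply: addS_r; case: ifP wl => [ini [g gU ->]|_ ->]; last by rewrite scaler0.
rewrite (leq_trans ini) // subSn //; exists (c *: g).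
  exact: seqS_mem.
by rewrite !scalerA mulrC.
Qed.

Lemma powS_level b s U n : powS (b :: s) n U <=s level b s U n.+1 n.
Proof.
elim: n => [|n IH].
  by move=> u Uu; apply: addS_r; exists u => //; rewrite expr0 scale1r.
apply: seqS_sub => c u; rewrite inE => /orP[/eqP ->|cs] /IH ul.
  exact: level_mul.
by apply: level_mono; apply: level_stable.
Qed.

(** As in Hilbert's basis theorem, these are the leading coefficients of the
elements of [W (n + i)] that have degree [i] in [b]. *)
Definition lead_car b s U W i n (g : N) : Prop := powS s n U g /\
  exists w d, [/\ W (n + i)%N w, level b s U i (n + i) d & b ^+ i *: g = w + d].

Lemma lead_closed b s U W i n : lead_car b s U W i n 0 /\
  forall a x y, lead_car b s U W i n x -> lead_car b s U W i n y ->
    lead_car b s U W i n (a *: x + y).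
Proof.
split; first by split; [exact: sub0 | exists 0, 0; rewrite scaler0 addr0].
move=> a x y [Ux [w [d [Ww dl xE]]]] [Uy [w' [d' [Ww' dl' yE]]]]; split.
  exact: subP.
exists (a *: w + w'), (a *: d + d'); split; try exact: subP.
by rewrite scalerDr scalerA mulrC -scalerA xE yE scalerDr addrACA.
Qed.

Definition lead b s U W i n : sub N := MkSub (lead_closed b s U W i n).

Lemma lead_stable b s U W i : stable s W -> stable s (lead b s U W i).
Proof.
move=> Wst c n u cs [Uu [w [d [Ww dl uE]]]]; split; first exact: seqS_mem.
exists (c *: w), (c *: d); split; [exact: Wst | exact: level_stable|].
by rewrite scalerA mulrC -scalerA uE scalerDr.
Qed.

Lemma lead_mono b s U W i n : stable [:: b] W ->
  lead b s U W i n <=s lead b s U W i.+1 n.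
Proof.
move=> Wst u [Uu [w [d [Ww dl uE]]]]; split=> //.
exists (b *: w), (b *: d); rewrite addnS; split.
- by apply: Wst; rewrite ?inE.
- exact: level_mul.
by rewrite exprS -scalerA uE scalerDr.
Qed.

Definition eventually_generated s W : Prop :=
  exists n0, forall n, (n0 <= n)%N -> W n.+1 <=s seqS s (W n).

(** The union of the chain is generated in degrees at most [n0], so the chain is
stationary as soon as it is so in these finitely many degrees. *)
Lemma stable_chain s (F : nat -> nat -> sub N) :
  (forall i n, F i n <=s F i.+1 n) -> (forall i, stable s (F i)) ->
  (forall Y, stable s Y -> (forall n, exists i, Y n <=s F i n) ->
     eventually_generated s Y) ->
  exists i0, forall i n, F i n <=s F i0 n.
Proof.
move=> Finc Fst gen.
have Fmono i j n : (i <= j)%N -> F i n <=s F j n.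
  by apply: (@incl_mono _ _ (fun i => F i n)).
have degP n : exists i0, forall i, F i n <=s F i0 n.
  have [i0 i0P] := max_cond_stable maxN (fun i => Finc i n).
  exists i0 => i; have [ii0|/ltnW] := leqP i i0; [exact: Fmono | exact: i0P].
have [k kP] := choice degP.
have [|n0 n0P] := gen (fun n => F (k n) n) _ (fun n => ex_intro _ (k n) (@incl_refl _ _ _)).
  by move=> b n u bs Fu; apply: (kP n.+1 (k n)); apply: Fst.
pose i0 := (\max_(n < n0.+1) k n)%N.
have i0P n : (n <= n0)%N -> forall i, F i n <=s F i0 n.
  move=> nn0 i; apply: incl_trans (kP n i) _; apply: Fmono.
  by rewrite -ltnS in nn0; apply: (@leq_bigmax _ (fun n : 'I_n0.+1 => k n) (Ordinal nn0)).
exists i0 => i n; elim: n i => [|n IH] i; first exact: i0P.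
have [nn0|n0n] := leqP n.+1 n0; first exact: i0P.
apply: incl_trans (kP n.+1 i) _; apply: incl_trans (n0P n n0n) _.
apply: seqS_sub => b u bs ku; apply: Fst => //; exact: IH ku.
Qed.

(** By induction on the number of generators, the families [lead i] are
generated in bounded degree, and they are stationary in [i]. An element of [W]
of large degree can then be reduced, by elements that come from lower degree, to
smaller and smaller degree in [b]. *)
Lemma rees_noetherian s U W : (forall n, W n <=s powS s n U) -> stable s W ->
  eventually_generated s W.
Proof.
elim: s W => [|b s IH] W WU Wst; first by exists 0%N => n _; apply: WU.
have Wsts : stable s W by move=> c n u cs; apply: Wst; rewrite inE cs orbT.
have Wstb : stable [:: b] W.
  by move=> c n u; rewrite inE => /eqP ->; apply: Wst; rewrite inE eqxx.
pose F := lead b s U W.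
have FU i n : F i n <=s powS s n U by move=> x [].
have Fst i : stable s (F i) by apply: lead_stable.
have [||Y Yst YF|i0 i0P] := @stable_chain s F.
- by move=> i n; apply: lead_mono.
- by [].
- by apply: IH => // n; have [i YFi] := YF n; apply: incl_trans YFi _.
have [k kP] := choice (fun i => IH (F i) (FU i) (Fst i)).
pose n2 := (\max_(i < i0.+1) k i)%N.
have kn2 i : (i <= i0)%N -> (k i <= n2)%N.
  by rewrite -ltnS => ii0; apply: (@leq_bigmax _ (fun i : 'I_i0.+1 => k i) (Ordinal ii0)).
exists (n2 + i0)%N => n n2n.
have Wn : seqS (b :: s) (W n) <=s W n.+1 by apply: seqS_sub => c u; apply: Wst.
suff Wl i w : W n.+1 w -> level b s U i n.+1 w -> seqS (b :: s) (W n) w.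
  by move=> w Ww; apply: (Wl n.+2) => //; apply: powS_level; apply: WU.
elim: i w => [|i IHi] w Ww; first by move=> ->; apply: sub0.
case=> d [x [dl xl wE]].
(* remove the leading term of w, modulo lower degree in b *)
suff [w' [d' [Ww' dl' xE]]] : addS (seqS (b :: s) (W n)) (level b s U i n.+1) x.
  rewrite -(subrK w' w); apply: subD => //; apply: IHi; first by apply: subB => //; exact: Wn.
  by rewrite wE xE [w' + d']addrC addrA addrK; apply: subD.
case: ifP xl => [ini [g gU xE]|_ ->]; last by apply: sub0.
have niE : (n.+1 - i + i = n.+1)%N by rewrite subnK.
have gF : F i (n.+1 - i)%N g.
  split=> //; exists w, (- d); rewrite niE; split=> //; first exact: subN.
  by rewrite wE -xE addrC addKr.
have [ii0|i0i] := leqP i i0.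
  have ni : (i <= n)%N by apply: leq_trans ii0 (leq_trans (leq_addl _ _) n2n).
  rewrite subSn // in gF.
  have h : seqS s (F i (n - i)%N) g.
    apply: (kP i) gF; apply: leq_trans (kn2 i ii0) _.
    by rewrite leq_subRL // addnC; apply: leq_trans n2n; rewrite leq_add2l.
  move: h; rewrite xE.
  suff sub : seqS s (F i (n - i)%N) <=s
      preS (GRing.scale (b ^+ i) : {linear N -> N})
           (addS (seqS (b :: s) (W n)) (level b s U i n.+1)) by exact: sub.
  apply: seqS_sub => c u cs [Uu [w' [d' [Ww' dl' uE]]]].
  rewrite subnK // in Ww' dl'.
  exists (c *: w'), (c *: d'); split.
  - by apply: seqS_mem; rewrite ?inE ?cs ?orbT.
  - exact: level_stable.
  by rewrite /= scalerA mulrC -scalerA uE scalerDr.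
case: i {IHi} dl i0i ini xE niE gF gU => // i dl i0i ini xE niE gF gU.
have {gF} [_ [w' [d' [Ww' dl' gE]]]] : F i (n.+1 - i.+1)%N g.
  apply: (@incl_mono _ _ (fun j => F j (n.+1 - i.+1)%N) _ i0 i) => //; last exact: i0P gF.
  by move=> j; apply: lead_mono.
rewrite subSS subnK // in Ww' dl' *.
exists (b *: w'), (b *: d'); split.
- by apply: seqS_mem; rewrite ?inE ?eqxx.
- exact: level_mul.
by rewrite xE exprS -scalerA gE scalerDr.
Qed.

(** The Artin-Rees lemma: the family [K :&: J ^ n U] is stable. *)
Lemma artin_rees s U K : K <=s U -> exists c, forall n,
  capS K (powS s (n + c) U) <=s powS s n K.
Proof.
move=> KU; have [|b n u bs [Ku Uu]|c cP] := @rees_noetherian s U (fun n => capS K (powS s n U)).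
- by move=> n; apply: capS_r.
- by split; [apply: subZ | apply: seqS_mem].
exists c; elim=> [|n IH]; first exact: capS_l.
apply: incl_trans (cP (n + c)%N (leq_addl _ _)) _; exact: seqSS.
Qed.

(** The same for the submodule [K / V] of [U / V]. *)
Lemma artin_rees_quo s V K U : V <=s K -> K <=s U -> exists c, forall n,
  capS K (addS V (powS s (n + c) U)) <=s addS V (powS s n K).
Proof.
move=> VK KU; have [c cP] := artin_rees s KU; exists c => n x [Kx [v [u [Vv Uu xE]]]].
exists v, u; split=> //; apply: cP; split=> //.
by apply: (@subDl _ _ _ v); [apply: VK | rewrite -xE].
Qed.

End Rees.

(** * Growth of functions of polynomial type *)

(** Eventually bounded by a multiple of the derivative of [n ^ k], that is, by
a polynomial with at most [k] coefficients; the value [0] of the bound for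
[k = 0] accounts for the zero polynomial. *)
Definition grows (k : nat) (f : nat -> nat) : Prop :=
  exists C n0, forall n, (n0 <= n)%N -> (f n <= C * (k * n ^ k.-1))%N.

Lemma grows_mono k l n : (0 < n)%N -> (k <= l)%N -> (k * n ^ k.-1 <= l * n ^ l.-1)%N.
Proof.
move=> n0 kl; apply: leq_mul => //; apply: leq_pexp2l => //.
by case: k l kl => // k [].
Qed.

Lemma grows_le k f g n1 : (forall n, (n1 <= n)%N -> (f n <= g n)%N) ->
  grows k g -> grows k f.
Proof.
move=> fg [C [n0 gC]]; exists C, (maxn n0 n1) => n; rewrite geq_max => /andP[h h'].
exact: leq_trans (fg n h') (gC n h).
Qed.

Lemma grows_add k f g : grows k f -> grows k g -> grows k (fun n => f n + g n)%N.
Proof.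
move=> [C [n0 fC]] [D [n1 gD]]; exists (C + D)%N, (maxn n0 n1) => n.
by rewrite geq_max mulnDl => /andP[h h']; apply: leq_add; auto.
Qed.

Lemma grows_mul k c f : grows k f -> grows k (fun n => c * f n)%N.
Proof.
by move=> [C [n0 fC]]; exists (c * C)%N, n0 => n h; rewrite -mulnA leq_mul2l fC ?orbT.
Qed.

Lemma grows_sum (I : Type) (r : seq I) k (f : I -> nat -> nat) :
  (forall i, grows k (f i)) -> grows k (fun n => \sum_(i <- r) f i n)%N.
Proof.
move=> fk; elim: r => [|i r IH].
  by exists 0%N, 0%N => n _; rewrite big_nil.
by apply: (@grows_le _ _ _ 0%N _ (grows_add (fk i) IH)) => n _; rewrite big_cons.
Qed.

Lemma grows_addn k c f : grows k f -> grows k (fun n => f (n + c)%N).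
Proof.
move=> [C [n0 fC]]; exists (C * c.+1 ^ k.-1)%N, n0.+1 => n n0n.
apply: leq_trans (fC _ (leq_trans (ltnW n0n) (leq_addr _ _))) _.
rewrite -mulnA leq_mul2l; apply/orP; right; rewrite mulnCA leq_mul2l; apply/orP; right.
rewrite -expnMn; case: k.-1 => // e; rewrite leq_exp2r //.
by rewrite mulSn leq_add2l leq_pmulr // (leq_ltn_trans _ n0n).
Qed.

Lemma grows_subn k c f : grows k f -> grows k (fun n => f (n - c)%N).
Proof.
move=> [C [n0 fC]]; exists C, (n0 + c).+1 => n n0n.
have h : (n0 <= n - c)%N by lia.
apply: leq_trans (fC _ h) _; rewrite leq_mul2l; apply/orP; right.
rewrite leq_mul2l; apply/orP; right; case: k.-1 => // e.
by rewrite leq_exp2r // leq_subr.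
Qed.

(** Together with [grows_addn]: the growth does not change under shifts. *)
Lemma grows_addnE k c f : grows k (fun n => f (n + c)%N) -> grows k f.
Proof.
move=> /(grows_subn c); apply: (@grows_le _ _ _ c) => n cn.
by rewrite subnK.
Qed.

Lemma grows_antidiff k f g n1 : (forall n, (n1 <= n)%N -> (f n.+1 <= f n + g n)%N) ->
  grows k g -> grows k.+1 f.
Proof.
move=> fg [C [n0 gC]]; pose m := (maxn n0 n1).+1.
have fm d : (f (m + d) <= f m + d * (C * (k * (m + d) ^ k.-1)))%N.
  elim: d => [|d IH]; first by rewrite addn0 leq_addr.
  rewrite addnS; have md1 : (n1 <= m + d)%N.
    by rewrite (leq_trans (leq_maxr n0 n1)) // /m addSn leqW // leq_addr.
  have md0 : (n0 <= m + d)%N.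
    by rewrite (leq_trans (leq_maxl n0 n1)) // /m addSn leqW // leq_addr.
  apply: leq_trans (fg _ md1) _; apply: leq_trans (leq_add IH (gC _ md0)) _.
  rewrite -addnA leq_add2l -mulSnr leq_mul2l /= leq_mul2l; apply/orP; right.
  rewrite leq_mul2l; apply/orP; right; case: k.-1 => // e.
  by rewrite leq_exp2r.
exists (f m + C * k)%N, m => n mn /=; rewrite -{1}(subnKC mn).
apply: leq_trans (fm _) _; rewrite subnKC // mulnDl; apply: leq_add.
  rewrite -{1}[f m]muln1 leq_mul2l; apply/orP; right.
  by rewrite muln_gt0 expn_gt0 (leq_trans _ mn).
rewrite mulnCA -mulnA; apply: leq_mul => //.
case: k {gC fm} => [|k] /=; first by rewrite mul0n muln0.
rewrite mulnCA leq_mul2l /= [X in (_ <= X)%N]mulnC -[X in (_ <= X)%N]mul1n.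
rewrite mul1n; apply: leq_trans (_ : (n * n ^ k <= _)%N).
  by rewrite leq_mul2r leq_subr orbT.
by rewrite -expnS leq_pmulr.
Qed.

Section Polynomials.
Implicit Types (p q r : {poly rat}) (f : nat -> rat).

Definition polytype f : Prop :=
  exists p n0, forall n, (n0 <= n)%N -> f n = p.[n%:R].

Lemma polytype_ext f g n1 : (forall n, (n1 <= n)%N -> f n = g n) ->
  polytype f -> polytype g.
Proof.
move=> fg [p [n0 fp]]; exists p, (maxn n0 n1) => n; rewrite geq_max => /andP[h h'].
by rewrite -fg // fp.
Qed.

Lemma polytypeD f g : polytype f -> polytype g -> polytype (fun n => f n + g n).
Proof.
move=> [p [n0 fp]] [q [n1 gq]]; exists (p + q), (maxn n0 n1) => n.
by rewrite geq_max hornerD => /andP[h h']; rewrite fp ?gq.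
Qed.

Lemma polytypeN f : polytype f -> polytype (fun n => - f n).
Proof. by move=> [p [n0 fp]]; exists (- p), n0 => n h; rewrite hornerN fp. Qed.

Lemma polytypeS f : polytype f -> polytype (fun n => f n.+1).
Proof.
move=> [p [n0 fp]]; exists (p \Po ('X + 1%:P)), n0 => n h.
by rewrite horner_comp !hornerE fp ?leqW // -natr1.
Qed.

Lemma polytype_sum (I : Type) (r : seq I) (f : I -> nat -> rat) :
  (forall i, polytype (f i)) -> polytype (fun n => \sum_(i <- r) f i n).
Proof.
move=> fk; elim: r => [|i r IH].
  by exists 0, 0%N => n _; rewrite big_nil horner0.
by apply: (@polytype_ext _ _ 0%N _ (polytypeD (fk i) IH)) => n _; rewrite big_cons.
Qed.

Definition delta p : {poly rat} := p \Po ('X + 1%:P) - p.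

Lemma delta_eval p n : (delta p).[n%:R] = p.[n.+1%:R] - p.[n%:R].
Proof. by rewrite hornerD hornerN horner_comp !hornerE natr1. Qed.

Lemma deltaMX q : delta (q * 'X) = delta q * ('X + 1%:P) + q.
Proof. by rewrite /delta comp_polyM comp_polyX; ring. Qed.

Lemma size_delta p : (size (delta p) <= (size p).-1)%N.
Proof.
elim/poly_ind: p => [|p c IH]; first by rewrite /delta comp_poly0 subrr size_poly0.
have -> : delta (p * 'X + c%:P) = delta (p * 'X).
  by rewrite /delta comp_polyD comp_polyC; ring.
rewrite deltaMX; have [->|p0] := eqVneq p 0.
  by rewrite /delta comp_poly0 subrr mul0r addr0 size_poly0.
rewrite size_MXaddC (negPf p0) /=; apply: leq_trans (size_polyD _ _) _.
rewrite geq_max leqnn andbT; apply: leq_trans (size_polyMleq _ _) _.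
have -> : size ('X + 1%:P : {poly rat}) = 2 by rewrite -[1%:P]opprK -polyCN size_XsubC.
rewrite addn2 /=; apply: leq_trans (_ : ((size p).-1.+1 <= _)%N) => //.
by rewrite prednK // size_poly_gt0.
Qed.

(** The falling factorials give preimages under [delta]. *)
Definition ffact s : {poly rat} := \prod_(j < s) ('X - (j%:R)%:P).

Lemma size_ffact s : size (ffact s) = s.+1.
Proof. by rewrite /ffact size_prod_XsubC [index_enum _]unlock -enumT size_enum_ord. Qed.

Lemma delta_ffact s : delta (ffact s.+1) = s.+1%:R *: ffact s.
Proof.
have sh t : ffact t.+1 \Po ('X + 1%:P) = ffact t * ('X + 1%:P).
  elim: t => [|t IH].
    by rewrite /ffact big_ord_recr !big_ord0 /= !mul1r polyC0 subr0 comp_polyX.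
  rewrite {1}/ffact big_ord_recr /= comp_polyM -/(ffact t.+1) IH.
  rewrite comp_polyB comp_polyX comp_polyC /ffact [in RHS]big_ord_recr /=.
  by rewrite -natr1 polyCD; ring.
rewrite /delta sh /ffact big_ord_recr /= -mul_polyC -natr1 polyCD; ring.
Qed.

Lemma delta_surj q : exists p, delta p = q.
Proof.
have [n] := ubnP (size q); elim: n q => // n IH q; rewrite ltnS => qn.
have [q0|q0] := eqVneq q 0; first by exists 0; rewrite /delta comp_poly0 subrr q0.
pose s := (size q).-1; pose c := lead_coef q.
have sq : size q = s.+1 by rewrite prednK // size_poly_gt0.
have [|p pE] := IH (q - (c / lead_coef (ffact s)) *: ffact s).
  apply: leq_trans qn; rewrite sq ltnS; apply/leq_sizeP => j.
  rewrite leq_eqVlt => /orP[/eqP <-|sj]; rewrite coefB coefZ.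
    rewrite /c /lead_coef size_ffact sq /= divfK ?subrr //.
    have : lead_coef (ffact s) != 0 by rewrite lead_coef_eq0 -size_poly_eq0 size_ffact.
    by rewrite /lead_coef size_ffact.
  by rewrite !nth_default ?size_ffact ?sq // mulr0 subr0.
exists (p + (c / lead_coef (ffact s) / s.+1%:R) *: ffact s.+1).
have dD u v : delta (u + v) = delta u + delta v by rewrite /delta comp_polyD; ring.
have dZ a u : delta (a *: u) = a *: delta u by rewrite /delta comp_polyZ scalerBr.
rewrite dD pE dZ delta_ffact scalerA divfK ?pnatr_eq0 //; exact: subrK.
Qed.

Lemma polytype_antidiff f : polytype (fun n => f n.+1 - f n) -> polytype f.
Proof.
move=> [q [n0 fq]]; have [p pE] := delta_surj q.
exists (p + (f n0 - p.[n0%:R])%:P), n0 => n h; rewrite -(subnKC h).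
elim: (n - n0)%N => [|d IH]; first by rewrite addn0 hornerD hornerC addrC subrK.
have := fq (n0 + d)%N (leq_addr _ _); rewrite -pE delta_eval addnS => fE.
move: IH fE; rewrite !hornerD !hornerC => -> fE; lra.
Qed.

Lemma poly_bound p k : (size p <= k)%N ->
  exists C : nat, forall n, (0 < n)%N -> `|p.[n%:R]| <= (C * (k * n ^ k.-1))%:R.
Proof.
move=> pk; pose B := \sum_(i < size p) `|p`_i|.
have B0 : 0 <= B by apply: sumr_ge0.
exists (Num.bound B) => n n0.
apply: le_trans (_ : B * (k * n ^ k.-1)%:R <= _); last first.
  by rewrite [X in _ <= X]natrM ler_wpM2r ?ler0n // ltW // archi_boundP.
rewrite horner_coef; apply: le_trans (ler_norm_sum _ _ _) _.
rewrite /B mulr_suml; apply: ler_sum => i _; rewrite normrM ler_wpM2l //.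
rewrite normrX normr_nat -natrX ler_nat.
have ik : (i < k)%N by apply: leq_trans (ltn_ord i) pk.
case: k ik pk => // k ik _; rewrite -[(n ^ i)%N]mul1n leq_mul // leq_pexp2l //.
Qed.

Lemma poly_grows p k (f : nat -> nat) n1 : (size p <= k)%N ->
  (forall n, (n1 <= n)%N -> (f n)%:R <= `|p.[n%:R]|) -> grows k f.
Proof.
move=> /poly_bound[C pC] fp; exists C, n1.+1 => n n1n.
rewrite -(ler_nat rat); apply: le_trans (fp n (ltnW n1n)) (pC n _).
exact: leq_ltn_trans n1n.
Qed.

(** Otherwise the leading term of [p] would be bounded by a multiple of a lower
power of [n]. *)
Lemma grows_size p k (f : nat -> nat) n1 : grows k f ->
  (forall n, (n1 <= n)%N -> (f n)%:R = p.[n%:R]) -> (size p <= k)%N.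
Proof.
move=> [C [n0 fC]] fp; rewrite leqNgt; apply/negP => kp.
have p0 : p != 0 by rewrite -size_poly_gt0 (leq_ltn_trans _ kp).
pose s := (size p).-1; pose a := lead_coef p.
have ps : size p = s.+1 by rewrite prednK // size_poly_gt0.
have a0 : 0 < `|a| by rewrite normr_gt0 lead_coef_eq0.
have sr : (size (p - a *: 'X^s)%R <= s)%N.
  apply/leq_sizeP => j; rewrite leq_eqVlt coefB coefZ coefXn => /orP[/eqP <-|sj].
    by rewrite eqxx mulr1 /a /lead_coef ps subrr.
  by rewrite nth_default ?ps // gtn_eqF // mulr0 subr0.
have [D rD] := poly_bound sr.
have key n : (maxn n0 n1 < n)%N -> `|a| * (n ^ s)%:R <= ((C + D) * (s * n ^ s.-1))%:R.
  rewrite gtn_max => /andP[h h']; have n_gt0 : (0 < n)%N by apply: leq_ltn_trans h.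
  have -> : `|a| * (n ^ s)%:R = `|p.[n%:R] - (p - a *: 'X^s).[n%:R]|.
    by rewrite !hornerE opprB addrC subrK normrM natrX [X in _ = _ * X]ger0_norm // exprn_ge0.
  apply: le_trans (ler_normB _ _) _; rewrite mulnDl natrD.
  apply: (lerD _ (rD n n_gt0)).
  rewrite -(fp n (ltnW h')) normr_nat ler_nat; apply: leq_trans (fC n (ltnW h)) _.
  by rewrite leq_mul2l grows_mono ?orbT // -ltnS -ps.
pose E := Num.bound (((C + D) * s)%:R / `|a|).
pose n := (maxn n0 n1 + E).+1.
have := key n; rewrite ltnS leq_addr => /(_ isT).
case: (s) @E @n => [|t] E n /=.
  by rewrite muln0 mulr1 leNgt a0.
rewrite leNgt => /negP; apply; rewrite expnS mulnA !natrM mulrA.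
rewrite -natrM ltr_pM2r ?ltr0n ?expn_gt0 // mulrC -ltr_pdivrMr //.
have : ((C + D) * t.+1)%:R / `|a| < E%:R by apply: archi_boundP; rewrite divr_ge0.
move/lt_le_trans; apply; rewrite ler_nat /n -addnS.
by rewrite (leq_trans (leqnSn E)) // leq_addl.
Qed.

Lemma size_grows p k (f : nat -> nat) n1 :
  (forall n, (n1 <= n)%N -> (f n)%:R = p.[n%:R]) ->
  grows k f <-> (size p <= k)%N.
Proof.
move=> fp; split=> [fk|pk]; first exact: grows_size fk fp.
by apply: (poly_grows pk (n1 := n1)) => n /fp <-; rewrite normr_nat.
Qed.

(** A difference of step [c] is a sum of [c] differences of step one, and [delta]
lowers the size. *)
Lemma grows_diff k c (f : nat -> nat) : polytype (fun n => (f n)%:R) ->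
  grows k.+1 f -> grows k (fun n => f (n + c)%N - f n)%N.
Proof.
move=> [p [n0 fp]] /(size_grows _ fp) pk.
have h1 : grows k (fun n => f n.+1 - f n)%N.
  apply: (@poly_grows (delta p) _ _ n0).
    by apply: leq_trans (size_delta p) _; case: (size p) pk.
  move=> n h; rewrite delta_eval -!fp ?leqW //.
  have [le|/ltnW le] := leqP (f n) (f n.+1); first by rewrite natrB // ler_norm.
  by move: (le); rewrite -subn_eq0 => /eqP ->; apply: normr_ge0.
elim: c => [|c IH].
  by exists 0%N, 0%N => n _; rewrite addn0 subnn.
apply: (@grows_le _ _ _ 0%N _ (grows_add (grows_addn c h1) IH)) => n _.
rewrite addnS; lia.
Qed.
End Polynomials.

(** * Finite length over a local ring *)

(** [s] generates an ideal that is primary to the maximal ideal [m], and [t]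
generates [m]. *)
Record local_primary (A : comNzRingType) (m : sub A^o) (s t : seq A) : Prop :=
  LocalPrimary {
  lp_max : max_cond A^o;
  lp_proper : ~ m (1 : A);
  lp_unit : forall a : A, ~ m a -> exists b, b * a = 1;
  lp_gen : forall a : A, m a <-> seqS t (fullS A^o) a;
  lp_sub : forall b : A, b \in s -> m b;
  lp_nil : forall a : A, m a -> exists e, seqS s (fullS A^o) (a ^+ e) }.

Lemma seqS_scale (A : comNzRingType) (N : lmodType A) (s : seq A) (U : sub N) (a : A) u :
  seqS s (fullS A^o) a -> U u -> seqS s U (a *: u).
Proof.
move=> sa Uu; suff h : seqS s (fullS A^o) <=s colS (seqS s U) U by apply: h.
apply: seqS_sub => b c bs _ v Uv; rewrite -scalerA; apply: seqS_mem => //; exact: subZ.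
Qed.

Section FiniteLength.
Variables (A : comNzRingType) (m : sub A^o) (s t : seq A).
Hypothesis loc : local_primary m s t.
Section OneModule.
Variable N : lmodType A.
Implicit Types (U V W X Y : sub N).

Lemma fin0 V U : U <=s V -> fin V U /\ len V U = 0%N.
Proof.
move=> UV; have [VU|nVU] := pselect (V <=s U); last exact: len_junk.
apply: len_uniq; first exact/chain0.
case=> // j [c [Vc cU cS]]; have cle := chain_le cS.
case: (cS 0%N isT) => _; case; apply: (incl_trans (W := U)).
  by apply: incl_trans cU; apply: cle; rewrite leqnn.
exact: incl_trans UV Vc.
Qed.

(** If [I] acts nilpotently on [U / V] then a non-zero element of [U / V] with
a maximal annihilator is killed by [m]. *)
Lemma socle n V U u : powS s n U <=s V -> U u -> ~ V u ->
  exists u', [/\ U u', ~ V u' & forall a : A, m a -> V (a *: u')].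
Proof.
move=> UV Uu nVu; pose F (D : sub A^o) := exists u, [/\ U u, ~ V u &
  D = colS V (lineS (fullS A^o) u)].
have colE w (a : A) : colS V (lineS (fullS A^o) w) a <-> V (a *: w).
  split=> [|Va _ [b _ ->]]; first by apply; apply: lineS_gen.
  by rewrite scalerA mulrC -scalerA; apply: subZ.
have [|_ [w [Uw nVw ->]] wmax] := lp_max loc (F := F).
  by exists (colS V (lineS (fullS A^o) u)), u.
exists w; split=> // a ma; apply: contrapT => nVaw.
have Vj j : ~ V (a ^+ j *: w).
  elim: j => [|j IH]; first by rewrite expr0 scale1r.
  rewrite exprSr -scalerA => Vajw; apply: IH; apply/colE.
  apply: (wmax (colS V (lineS (fullS A^o) (a *: w)))); last exact/colE.
    by exists (a *: w); split=> //; apply: subZ.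
  move=> c /colE Vc; apply/colE; rewrite scalerA mulrC -scalerA; exact: subZ.
have [e ae] := lp_nil loc ma; apply: (Vj (e * n)%N); apply: UV.
rewrite exprM; elim: n => [|n IH]; first by rewrite expr0 scale1r.
by rewrite exprS -scalerA; apply: seqS_scale.
Qed.

Lemma fin_simple V u : (forall a : A, m a -> V (a *: u)) ->
  fin V (addS V (lineS (fullS A^o) u)).
Proof.
move=> mu; exists 1%N => j [c [Vc cU cS]]; rewrite leqNgt; apply/negP => j1.
have cle := chain_le cS.
have [c1 nc1] := cS 0%N (ltnW j1); have [c2 nc2] := cS 1%N j1.
have [x cx nx] : exists2 x, c 1%N x & ~ c 0%N x.
  apply: contrapT => h; apply: nc1 => x cx; apply: contrapT => nx; apply: h.
  by exists x.
have cin i : (i <= j)%N -> c i <=s addS V (lineS (fullS A^o) u).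
  by move=> ij; apply: incl_trans cU; apply: cle; rewrite ij leqnn.
have [v [_ [Vv [a _ ->] xE]]] := cin 1%N (ltnW j1) x cx.
have cv : c 1%N v by apply/c1/Vc.
have nma : ~ m a.
  by move=> /mu Vau; apply: nx; rewrite xE; apply: Vc; apply: subD.
have [b ba] := lp_unit loc nma.
have cu : c 1%N u.
  rewrite -[u]scale1r -ba -scalerA; apply: subZ; apply: (@subDl _ _ _ v) => //.
  by rewrite -xE.
apply: nc2; apply: incl_trans (cin 2%N j1) _; apply: addS_sub.
  exact: incl_trans Vc c1.
exact: lineS_sub.
Qed.

Hypothesis maxN : max_cond N.

(** Take a maximal [W] such that [W / V] has finite length; by [socle] it could be
extended by a simple module if it were not [U]. *)
Lemma fin_nilpotent n V U : powS s n U <=s V -> fin V U.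
Proof.
move=> UV; have [VU|nVU] := pselect (V <=s U); last by have [] := len_junk nVU.
have [|W [VW WU fW] Wmax] := maxN (F := fun W => [/\ V <=s W, W <=s U & fin V W]).
  by exists V; split=> //; case: (fin0 (@incl_refl _ _ V)).
suff UW : U <=s W by have [] := len_mono (@incl_refl _ _ V) VU UW fW.
move=> u Uu; apply: contrapT => nWu.
have [w [Uw nWw mw]] := socle (incl_trans UV VW) Uu nWu.
apply: nWw; apply: (Wmax (addS W (lineS (fullS A^o) w))) => //; last first.
  by apply: addS_r; apply: lineS_gen.
split; first by apply: incl_trans VW _; exact: addS_l.
  by apply: addS_sub => //; apply: lineS_sub.
by have [] := len_add VW (@addS_l _ _ W _) fW (fin_simple mw).
Qed.

(** Nakayama's lemma. A maximal [W] over [V] that does not contain [U] would have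
[(U + W) / W] cyclic, generated by some [z] with [(1 - a) z = 0], [a] in [m]. *)
Lemma nakayama V U : U <=s addS V (seqS s U) -> U <=s V.
Proof.
move=> UVI; apply: contrapT => nUV.
have [|W [VW nUW] Wmax] := maxN (F := fun W => V <=s W /\ ~ U <=s W).
  by exists V.
have [z Uz nWz] : exists2 z, U z & ~ W z.
  apply: contrapT => h; apply: nUW => x Ux; apply: contrapT => nx; apply: h.
  by exists x.
have UWz : U <=s addS W (lineS (fullS A^o) z).
  apply: contrapT => nU; apply: nWz; apply: (Wmax (addS W (lineS (fullS A^o) z))) => //.
    by split=> //; apply: incl_trans VW _; exact: addS_l.
  by apply: addS_r; apply: lineS_gen.
have [w [_ [Ww [a ma ->] zE]]] : addS W (lineS m z) z.
  have : addS V (seqS s U) <=s addS W (lineS m z).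
    apply: addS_sub; first by apply: incl_trans VW _; exact: addS_l.
    apply: incl_trans (seqSS UWz) _; apply: seqS_sub => b _ bs [w [_ [Ww [a _ ->] ->]]].
    rewrite scalerDr; apply: subD; first by apply: addS_l; apply: subZ.
    apply: addS_r; rewrite scalerA; exists (b * a) => //; apply: idMr.
    exact: (lp_sub loc).
  by apply; apply: UVI.
have [|b ba] := lp_unit loc (a := 1 - a).
  by move=> m1a; apply: (lp_proper loc); rewrite -(subrK a 1); apply: idD.
apply: nWz; rewrite -[z]scale1r -ba -scalerA; apply: subZ.
by rewrite scalerBl scale1r {1}zE addrK.
Qed.

End OneModule.

(** [A / I] has finite length: there are [u_1], ..., [u_L] that generate [A] modulo
[I] and such that [m u_i] lies in [I + (u_(i+1), ..., u_L)]. So [U / I U] is an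
extension of [L] quotients of [U / m U]. *)
Lemma len_primary_le : exists L, forall (N : lmodType A) (U : sub N), max_cond N ->
  (len (seqS s U) U <= L * len (seqS t U) U)%N.
Proof.
(* each entry of the list is killed by m modulo I and the entries after it *)
pose good := fix good (r : seq A) := if r is u :: r' then
  good r' /\ forall a, m a -> seqS (r' ++ s) (fullS A^o) (a * u) else True.
have [|_ [r [gr ->]] rmax] := lp_max loc
  (F := fun D => exists r, good r /\ D = seqS (r ++ s) (fullS A^o)).
  by exists (seqS s (fullS A^o)), [::].
have r1 : seqS (r ++ s) (fullS A^o) (1 : A).
  apply: contrapT => n1.
  have [|//|//|u [_ nu mu]] := @socle _ 1 (seqS (r ++ s) (fullS A^o)) (fullS A^o) (1 : A).
    by apply: seqS_sub => b u bs _; apply: seqS_mem; rewrite // mem_cat bs orbT.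
  apply: nu; apply: (rmax (seqS (@cons A u (r ++ s)) (fullS A^o))).
  - by exists (@cons A u r).
  - exact: addS_r.
  have := @seqS_mem A A^o (@cons A u (r ++ s)) u (fullS A^o) (1 : A) (mem_head _ _) I.
  by rewrite [_ *: _]mulr1.
exists (size r) => N U maxN.
have fm : fin (seqS t U) U.
  apply: (fin_nilpotent maxN (n := 1)); apply: seqS_sub => b u bs Uu.
  by apply: seqS_scale => //; apply/(lp_gen loc)/(lp_sub loc).
have fs r' : fin (seqS s U) (seqS (r' ++ s) U).
  have [] // := @len_mono _ _ (seqS s U) (seqS (r' ++ s) U) (seqS s U) U.
    by apply: seqS_sub => b u bs; apply: seqS_mem; rewrite mem_cat bs orbT.
  - exact: seqS_le.
  exact: (fin_nilpotent maxN (n := 1)).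
apply: (@leq_trans (len (seqS s U) (seqS (r ++ s) U))).
  have [] // := @len_mono _ _ (seqS s U) U (seqS s U) (seqS (r ++ s) U).
  - exact: seqS_le.
  by move=> u Uu; rewrite -[u]scale1r; apply: seqS_scale.
elim: r gr {rmax r1} => [|u r IH] /=; first by have [_ ->] := fin0 (@incl_refl _ _ (seqS s U)).
move=> [/IH le1 mu]; rewrite mulSn addnC.
have ss : seqS s U <=s seqS (r ++ s) U.
  by apply: seqS_sub => b v bs; apply: seqS_mem; rewrite mem_cat bs orbT.
have [] := @len_surj _ _ _ (GRing.scale u : {linear N -> N}) (seqS t U) U
  (seqS (r ++ s) U) (seqS (u :: r ++ s) U) (@seqS_le _ _ t U) fm.
- apply: seqS_sub => b v bt Uv /=; rewrite scalerA mulrC.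
  apply: seqS_scale => //; apply: mu; apply/(lp_gen loc).
  by rewrite -[b]mulr1; apply: seqS_mem.
- by apply: addS_sub => [_ [v Uv ->]|]; [apply: addS_l; exists v | apply: addS_r].
move=> f1 le2.
have [_ ->] := len_add ss (@addS_r _ _ (mulS u U) _) (fs r) f1.
exact: leq_add.
Qed.

End FiniteLength.

(** * Hilbert-Samuel functions *)

(** The Hilbert-Serre theorem for the graded module with components [U n / V n].
Multiplication by [b] has a kernel [K / V] and a cokernel [U / L] on which [b]
acts as zero, so that they are generated in bounded degree by the other
elements. The difference of the length function of [U / V] is, up to a shift,
that of [U / L] minus that of [K / V]. *)
Lemma hilbert_serre (A : comNzRingType) (N : lmodType A) (r : seq A) (V U : nat -> sub N) :
  stable r V -> stable r U -> (forall n, V n <=s U n) ->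
  (forall n, fin (V n) (U n)) ->
  (forall W, stable r W -> (forall n, V n <=s W n /\ W n <=s U n) ->
     exists n0, forall n, (n0 <= n)%N -> W n.+1 <=s addS (V n.+1) (seqS r (W n))) ->
  polytype (fun n => (len (V n) (U n))%:R).
Proof.
elim: r V U => [|b r IH] V U Vst Ust VU fVU gen.
  have [n0 n0P] := gen U Ust (fun n => conj (VU n) (@incl_refl _ _ (U n))).
  exists 0, n0.+1 => -[//|n] nn0; rewrite horner0.
  have UV : U n.+1 <=s V n.+1.
    by apply: incl_trans (n0P n nn0) _; apply: addS_sub => //; apply: zeroS_sub.
  by have [_ ->] := fin0 UV.
have bb : b \in b :: r by rewrite inE eqxx.
have rb c : c \in r -> c \in b :: r by rewrite inE orbC => ->.
pose K n := divS b (V n.+1) (U n).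
pose L n := if n is n'.+1 then addS (V n) (mulS b (U n')) else V n.
have VK n : V n <=s K n by move=> v Vv; split; [apply: VU | apply: Vst].
have KU n : K n <=s U n by move=> v [].
have VL n : V n <=s L n by case: n => // n; apply: addS_l.
have LU n : L n <=s U n.
  case: n => [|n]; first exact: VU.
  by apply: addS_sub; [apply: VU | move=> _ [u Uu ->]; apply: Ust].
have fVK n : fin (V n) (K n) by case: (len_mono (@incl_refl _ _ _) (VK n) (KU n) (fVU n)).
have fKU n : fin (K n) (U n) by case: (len_mono (VK n) (KU n) (@incl_refl _ _ _) (fVU n)).
have fVL n : fin (V n) (L n) by case: (len_mono (@incl_refl _ _ _) (VL n) (LU n) (fVU n)).
have fLU n : fin (L n) (U n) by case: (len_mono (VL n) (LU n) (@incl_refl _ _ _) (fVU n)).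
have polyK : polytype (fun n => (len (V n) (K n))%:R).
  apply: IH => //.
  - by move=> c n u cr; apply: Vst; apply: rb.
  - move=> c n u cr [Uu Vu]; split; first by apply: Ust => //; apply: rb.
    by rewrite scalerA mulrC -scalerA; apply: Vst => //; apply: rb.
  move=> W Wst VWK; have bW n u : W n u -> V n.+1 (b *: u).
    by have [_ h] := VWK n; move/h => [].
  have [||n0 n0P] := gen W.
  - move=> c n u; rewrite inE => /orP[/eqP -> Wu|]; last exact: Wst.
    by have [h _] := VWK n.+1; apply/h/bW.
  - by move=> n; have [h h'] := VWK n; split=> //; apply: incl_trans h' _.
  exists n0 => n /n0P h; apply: incl_trans h _; apply: addS_sub => //.
  by apply: addS_sub; [move=> _ [u Wu ->]; apply/addS_l/bW | apply: addS_r].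
have polyL : polytype (fun n => (len (L n) (U n))%:R).
  apply: IH => //.
  - move=> c n u cr Lu.
    have {Lu} : exists v w, [/\ V n v, addS (V n.+1) (mulS b (U n)) (c *: w) & u = v + w].
      case: n Lu => [|n] Lu.
        by exists u, 0; rewrite addr0 scaler0; split=> //; apply: sub0.
      case: Lu => v [_ [Vv [w Uw ->] ->]]; exists v, (b *: w); split=> //.
      apply: addS_r; exists (c *: w); last by rewrite !scalerA mulrC.
      by apply: Ust => //; apply: rb.
    case=> v [w [Vv cw ->]]; rewrite scalerDr; apply: subD => //.
    by apply: addS_l; apply: Vst => //; apply: rb.
  - by move=> c n u cr; apply: Ust; apply: rb.
  move=> W Wst LWU; have [||n0 n0P] := gen W.
  - move=> c n u; rewrite inE => /orP[/eqP -> Wu|]; last exact: Wst.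
    have [h _] := LWU n.+1; apply/h/addS_r; exists u => //.
    by have [_] := LWU n; apply.
  - by move=> n; have [h h'] := LWU n; split=> //; apply: incl_trans h.
  exists n0 => n /n0P h; apply: incl_trans h _; apply: addS_sub.
    by apply: incl_trans (@addS_l _ _ (L n.+1) _); apply: addS_l.
  apply: addS_sub; last exact: addS_r.
  move=> _ [u Wu ->]; apply/addS_l/addS_r; exists u => //.
  by have [_] := LWU n; apply.
apply: polytype_antidiff.
apply: (@polytype_ext _ _ 0%N _ (polytypeD (polytypeS polyL) (polytypeN polyK))) => n _.
have [_ ->] := len_add (VL n.+1) (LU n.+1) (fVL _) (fLU _).
have [_ ->] := len_add (VK n) (KU n) (fVK _) (fKU _).
have [|||||||_ ->] := @len_iso _ _ _ (GRing.scale b : {linear N -> N}) (K n) (U n)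
  (V n.+1) (L n.+1) => //.
- by move=> u Uu; apply: addS_r; exists u.
- by move=> u [].
- by apply: addS_sub; [apply: addS_r | move=> _ [u Uu ->]; apply: addS_l; exists u].
by rewrite !natrD; ring.
Qed.

Section HilbertSamuel.
Variables (A : comNzRingType) (m : sub A^o) (s t : seq A).
Hypothesis loc : local_primary m s t.
Variable N : lmodType A.
Hypothesis maxN : max_cond N.
Implicit Types (U V W X Y : sub N).

(** The Hilbert-Samuel function of [U / V]. *)
Definition chi V U (n : nat) : nat := len (addS V (powS s n U)) U.

Lemma fin_powS n V U : powS s n U <=s V -> fin V U.
Proof. by move=> h; apply: (fin_nilpotent loc maxN) h. Qed.

Lemma fin_chi V U n : fin (addS V (powS s n U)) U.
Proof. by apply: fin_powS; apply: addS_r. Qed.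

Lemma chi_sub V U n : V <=s U -> addS V (powS s n U) <=s U.
Proof. by move=> VU; apply: addS_sub => //; apply: powS_le. Qed.

Lemma chi_diff V U n : V <=s U ->
  chi V U n.+1 = (len (addS V (powS s n.+1 U)) (addS V (powS s n U)) + chi V U n)%N.
Proof.
move=> VU; have h : addS V (powS s n.+1 U) <=s addS V (powS s n U).
  by apply: addSS => //; apply: seqS_le.
rewrite /chi; have [//||_ ->] // := len_add h (chi_sub VU).
  by case: (len_mono (@incl_refl _ _ _) h (chi_sub VU) (fin_chi V U n.+1)).
exact: fin_chi.
Qed.

(** Apply the Hilbert-Serre theorem to the associated graded module. *)
Lemma chi_poly V U : V <=s U -> polytype (fun n => (chi V U n)%:R).
Proof.
move=> VU; apply: polytype_antidiff.
have Ust k : stable s (fun n => addS V (powS s (n + k) U)).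
  move=> b n u bs [v [w [Vv Uw ->]]]; exists (b *: v), (b *: w).
  by rewrite scalerDr; split=> //; [apply: subZ | apply: seqS_mem].
have U1 n : addS V (powS s n.+1 U) <=s addS V (powS s n U).
  by apply: addSS => //; apply: seqS_le.
apply: (@polytype_ext (fun n =>
  (len (addS V (powS s (n + 1) U)) (addS V (powS s (n + 0) U)))%:R) _ 0%N).
  move=> n _; rewrite chi_diff // addn1 addn0 natrD; ring.
apply: (@hilbert_serre _ _ s) => //.
- by move=> n; rewrite addn1 addn0.
- move=> n; rewrite addn1 addn0.
  by case: (len_mono (@incl_refl _ _ _) (U1 n) (chi_sub VU) (fin_chi V U n.+1)).
move=> W Wst VWU.
have [||n0 n0P] := @rees_noetherian _ _ maxN s U (fun n => capS (W n) (powS s n U)).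
- by move=> n; apply: capS_r.
- by move=> b n u bs [Wu Uu]; split; [apply: Wst | apply: seqS_mem].
exists n0 => n n0n w Ww; have [h h'] := VWU n.+1.
have [v [u [Vv Uu wE]]] := h' w Ww; rewrite addn0 in Uu.
rewrite wE; apply: subD; first by apply: addS_l; apply: addS_l.
apply: addS_r; have Wu : W n.+1 u.
  by apply: (@subDl _ _ _ v); [apply: h; apply: addS_l | rewrite -wE].
by apply: (seqSS (@capS_l _ _ (W n) (powS s n U))); apply: n0P.
Qed.

(** * Krull dimension and the degree of the Hilbert-Samuel function *)

Definition is_prime (P : sub A^o) : Prop :=
  ~ P (1 : A) /\ forall a b : A, P (a * b) -> P a \/ P b.

Definition prime_chain (J : sub A^o) (k : nat) : Prop := exists c : nat -> sub A^o,
  (forall i, (i <= k)%N -> is_prime (c i) /\ J <=s c i) /\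
  forall i, (i < k)%N -> c i <=s c i.+1 /\ ~ c i.+1 <=s c i.

(** The filtration that [U] induces on [K] is contained in a shift of the [I]-adic
one. *)
Lemma chi_artin_rees V K U : V <=s K -> K <=s U ->
  exists c, forall n, (chi V K n <= chi V U (n + c))%N.
Proof.
move=> VK KU; have [c cP] := artin_rees_quo maxN s VK KU; exists c => n.
have [] // := @len_inj _ _ _ idfun (addS V (powS s n K)) K (addS V (powS s (n + c) U)) U.
- exact/chi_sub/(incl_trans VK).
- exact: fin_chi.
by move=> u Ku Vu; apply: cP.
Qed.

Lemma chi_quotient V V' U n : V <=s V' -> V' <=s U -> (chi V' U n <= chi V U n)%N.
Proof.
move=> VV' V'U; have [] // := @len_mono _ _ (addS V' (powS s n U)) U (addS V (powS s n U)) U.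
- exact: addSS.
- exact: chi_sub.
exact: fin_chi.
Qed.

(** Additivity of length for the image of [W] in [U / (V + I ^ n U)]. *)
Lemma chi_exact V W U n : V <=s W -> W <=s U ->
  chi V U n = (len (addS V (powS s n U)) (addS W (powS s n U)) + chi W U n)%N.
Proof.
move=> VW WU; have h : addS V (powS s n U) <=s addS W (powS s n U) by apply: addSS.
rewrite /chi; have [//||_ ->] // := len_add h (chi_sub WU).
  by case: (len_mono (@incl_refl _ _ _) h (chi_sub WU) (fin_chi V U n)).
exact: fin_chi.
Qed.


(** Otherwise each [g] in [U] is mapped into [V] by some element outside [P]. As
these elements are closed under products, a maximal submodule of [U] that a
single one of them maps into [V] is [U] itself. The conclusion makes [A / P] a
quotient of the submodule of [U / V] that [g] generates. *)
Lemma prime_witness P V U : is_prime P -> colS V U <=s P -> V <=s U ->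
  exists2 g, U g & forall a : A, V (a *: g) -> P a.
Proof.
move=> [P1 Pp] VUP VU; apply: contrapT => nog.
have kill g : U g -> exists2 a : A, ~ P a & V (a *: g).
  move=> Ug; apply: contrapT => h; apply: nog; exists g => // a Va.
  by apply: contrapT => nPa; apply: h; exists a.
have [|W [VW WU [a nPa aW]] Wmax] := maxN (F := fun W => [/\ V <=s W, W <=s U &
   exists2 a : A, ~ P a & forall w, W w -> V (a *: w)]).
  by exists V; split=> //; exists 1 => // w; rewrite scale1r.
apply: (nPa); apply: VUP => u Uu; apply: (aW).
have [b nPb Vbu] := kill u Uu.
apply: (Wmax (addS W (lineS (fullS A^o) u))) => //; last first.
  by apply: addS_r; apply: lineS_gen.
split; first by apply: incl_trans VW _; exact: addS_l.
  by apply: addS_sub => //; apply: lineS_sub.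
exists (a * b); first by move=> /Pp[/nPa|/nPb].
move=> _ [w [_ [Ww [c _ ->] ->]]]; rewrite scalerDr; apply: subD.
  by rewrite mulrC -scalerA; apply/subZ/aW.
by rewrite scalerA -mulrA [b * c]mulrC mulrA -scalerA; apply: subZ.
Qed.

(** Let [E = A / P] for the first prime [P] of the chain; it is a subquotient of
[U / V], so it grows at most as fast. An element [x] of the second prime outside
[P] is regular on [E], and by the Artin-Rees lemma the Hilbert-Samuel function of
[E / x E] is at most a difference of that of [E]; so it grows more slowly by
one, and the remaining primes contain its annihilator. *)
Lemma grows_no_chain k V U : V <=s U -> prime_chain (colS V U) k -> ~ grows k (chi V U).
Proof.
elim: k V U => [|k IH] V U VU [c [cP cS]].
  case=> C [n0 /(_ n0.+1 (leqnSn _))]; rewrite mul0n muln0 leqn0 => /eqP chi0.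
  have [[n1 _] VUP] := cP 0%N isT; apply/n1/VUP => u Uu; rewrite scale1r.
  apply: (nakayama loc maxN) Uu; apply: incl_trans (len_eq0 _ (fin_chi V U n0.+1) chi0) _.
    exact: chi_sub.
  by apply: addSS => //; apply/seqSS/powS_le.
have [Pp VUP] := cP 0%N isT; have [P1 Pprime] := Pp.
have [g Ug gP] := prime_witness Pp VUP VU; set P := c 0%N in Pp VUP P1 Pprime gP.
pose V1 := addS V (lineS P g); pose U1 := addS V (lineS (fullS A^o) g).
have VV1 : V <=s V1 by apply: addS_l.
have V1U1 : V1 <=s U1 by apply: addSS => // _ [p _ ->]; exists p.
have U1U : U1 <=s U by apply: addS_sub => //; apply: lineS_sub.
have g1 : U1 g by apply: addS_r; apply: lineS_gen.
have V1E (a : A) : V1 (a *: g) -> P a.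
  case=> v [_ [Vv [p Pp' ->] agE]]; rewrite -(subrK p a); apply: idD => //.
  by apply: gP; rewrite scalerBl agE addrK.
have inj (y : A) u : ~ P y -> U1 u -> V1 (y *: u) -> V1 u.
  move=> nPy [v [_ [Vv [a _ ->] ->]]]; rewrite scalerDr scalerA => h.
  apply: subD; first exact: VV1.
  have /V1E/Pprime[//|Pa] : V1 ((y * a) *: g).
    by apply: (@subDl _ _ _ (y *: v)) => //; apply/VV1/subZ.
  by apply: addS_r; exists a.
(* E = A / P is realized as U1 / V1, with U1 = V + A g and V1 = V + P g *)
move=> gVU; have g1VU : grows k.+1 (chi V1 U1).
  have [d dP] := chi_artin_rees (V := V) (incl_trans VV1 V1U1) U1U.
  apply: (@grows_le _ _ _ 0%N _ (grows_addn d gVU)) => n _.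
  by apply: leq_trans (dP n); apply: chi_quotient.
have [c01 nc01] := cS 0%N isT.
have [x cx nPx] : exists2 x : A, c 1%N x & ~ P x.
  apply: contrapT => h; apply: nc01 => x cx; apply: contrapT => nx; apply: h.
  by exists x.
pose V2 := addS V1 (mulS x U1).
have V1V2 : V1 <=s V2 by apply: addS_l.
have V2U1 : V2 <=s U1 by apply: addS_sub => //; apply: mulS_sub.
have chi12 n : chi V1 U1 n = chi V1 V2 n.
  symmetry; have [] // := @len_iso _ _ _ (GRing.scale x : {linear N -> N})
    (addS V1 (powS s n U1)) U1 (addS V1 (powS s n V2)) V2.
  - exact: chi_sub.
  - exact: chi_sub.
  - exact: fin_chi.
  - by move=> u Uu; apply: addS_r; exists u.
  - apply: addS_sub; first by move=> v Vv; apply/addS_l/subZ.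
    have h : U1 <=s preS (GRing.scale x : {linear N -> N}) V2.
      by move=> u Uu; apply: addS_r; exists u.
    by move=> u Uu; apply: addS_r; apply: (powS_map h).
  - move=> u Uu [v [w [Vv Vw uE]]].
    have [v' [_ [Vv' [w' Uw' ->] wE]]] : addS V1 (mulS x (powS s n U1)) w.
      by apply: addSS (powS_addS Vw) => //; [apply: powS_le | apply: powS_mulS].
    rewrite -(subrK w' u); apply: subD; last exact: addS_r.
    apply: addS_l; apply: (inj x) => //; first by apply: subB => //; apply: powS_le Uw'.
    rewrite scalerBr uE wE addrA addrK; exact: subD.
  apply: addS_sub; first by apply: incl_trans (@addS_r _ _ _ _); apply: addS_l.
  by move=> _ [u Uu ->]; apply: addS_l; exists u.
have [d dP] := artin_rees_quo maxN s V1V2 V2U1.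
apply: (IH V2 U1 V2U1).
  exists (fun i => c i.+1); split=> [i ik|i ik]; last exact: cS.
  have [h _] := cP i.+1 ik; split=> // a aP.
  have : c 1%N a.
    have [v [_ [V1v [_ [v' [_ [Vv' [b _ ->] ->]]] ->] agE]]] := aP g g1.
    rewrite -(subrK (x * b) a); apply: idD; last exact: idMr.
    apply/c01/V1E; rewrite scalerBl agE scalerDr addrA -scalerA addrK.
    by apply: subD => //; apply/VV1/subZ.
  move: a {aP}; change (c 1%N <=s c i.+1).
  elim: i ik {h} => // i IHi ik; apply: incl_trans (IHi (ltnW ik)) _.
  by case: (cS i.+1 ik).
apply: (@grows_addnE _ d).
apply: (@grows_le _ _ _ 0%N _ (grows_diff d (chi_poly V1U1) g1VU)) => n _.
suff : (chi V1 U1 n + chi V2 U1 (n + d) <= chi V1 U1 (n + d))%N by lia.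
rewrite (chi_exact (n + d) V1V2 V2U1) leq_add2r chi12.
have [] // := @len_inj _ _ _ idfun (addS V1 (powS s n V2)) V2
  (addS V1 (powS s (n + d) U1)) (addS V2 (powS s (n + d) U1)).
- exact: addSS.
- have h : addS V1 (powS s (n + d) U1) <=s addS V2 (powS s (n + d) U1) by apply: addSS.
  by case: (len_mono (@incl_refl _ _ _) h (chi_sub V2U1) (fin_chi V1 U1 (n + d))).
- by move=> u V2u; apply: addS_l.
by move=> u V2u Vu; apply: dP.
Qed.

(** Multiplication by [a] maps [U / (V : a)] onto the kernel of
[U / V -> U / (V + a U)]; the shift [e] accounts for [a] in [I]. *)
Lemma chi_mul (a : A) V U n e : V <=s U ->
  (forall u, powS s n U u -> powS s (n + e) U (a *: u)) ->
  (chi V U (n + e) <= chi (divS a V U) U n + chi (addS V (mulS a U)) U (n + e))%N.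
Proof.
move=> VU aU; have VaU : addS V (mulS a U) <=s U by apply: addS_sub => //; apply: mulS_sub.
rewrite (chi_exact (n + e) (@addS_l _ _ V (mulS a U)) VaU) leq_add2r.
have [] // := @len_surj _ _ _ (GRing.scale a : {linear N -> N}) (addS (divS a V U) (powS s n U)) U
  (addS V (powS s (n + e) U)) (addS (addS V (mulS a U)) (powS s (n + e) U)).
- by apply: chi_sub => u [].
- exact: fin_chi.
- apply: addS_sub => [u [_ Vau]|u Uu]; first exact: addS_l.
  by apply: addS_r; apply: aU.
apply: addS_sub; last first.
  by apply: incl_trans (@addS_r _ _ (imS _ U) _); apply: addS_r.
apply: addS_sub; first by apply: incl_trans (@addS_r _ _ (imS _ U) _); apply: addS_l.
by move=> _ [u Uu ->]; apply: addS_l; exists u.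
Qed.

(** Let [U / W] be minimal among the quotients of large growth. If [a b] kills it
but neither [a] nor [b] does, then by [chi_mul] it grows no faster than two proper
quotients, those by the kernel of [a] and by [a U]. *)
Lemma prime_quotient k V U : V <=s U -> ~ grows k (chi V U) ->
  exists W, [/\ V <=s W, W <=s U, ~ grows k (chi W U) & is_prime (colS W U)].
Proof.
move=> VU ng; have [|W [VW WU nW] Wmax] := maxN
  (F := fun W => [/\ V <=s W, W <=s U & ~ grows k (chi W U)]); first by exists V.
have Wgrows X : W <=s X -> X <=s U -> ~ X <=s W -> grows k (chi X U).
  move=> WX XU nXW; apply: contrapT => nX; apply: nXW; apply: Wmax => //.
  by split=> //; apply: incl_trans WX.
exists W; split=> //; split=> [P1|a b Pab].
  apply: nW; exists 0%N, 0%N => n _; rewrite /chi.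
  have UW : U <=s addS W (powS s n U) by move=> u /P1; rewrite scale1r; apply: addS_l.
  by have [_ ->] := fin0 UW.
apply: contrapT => /not_orP[nPa nPb]; apply: nW.
have VaU : addS W (mulS a U) <=s U by apply: addS_sub => //; apply: mulS_sub.
have ga : grows k (chi (addS W (mulS a U)) U).
  apply: Wgrows => // h; apply: nPa => u Uu; apply: h; apply: addS_r; by exists u.
have gb : grows k (chi (divS a W U) U).
  apply: Wgrows => [u Wu|u []//|h]; first by split; [apply: WU | apply: subZ].
  apply: nPb => u Uu; apply: h; split; first exact: subZ.
  by rewrite scalerA; apply: Pab.
apply: (@grows_le _ _ _ 0%N _ (grows_add gb ga)) => n _.
have := @chi_mul a W U n 0 WU; rewrite addn0; apply=> u; exact: subZ.
Qed.

(** The annihilator of the minimal quotient starts the chain; reducing that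
quotient modulo an element of [I] lowers the growth by at most one, and induction
gives the larger primes. *)
Lemma chain_of_growth k V U : V <=s U -> ~ grows k (chi V U) -> prime_chain (colS V U) k.
Proof.
elim: k V U => [|k IH] V U VU /(prime_quotient VU)[W [VW WU nW Pprime]].
  exists (fun=> colS W U); split=> // i _; split=> // a aV u Uu; exact/VW/aV.
have [x xs nPx] : exists2 x, x \in s & ~ colS W U x.
  apply: contrapT => h; apply: nW; exists (len W U), 1%N => -[//|n] _ /=.
  apply: (@leq_trans (len W U)); last by rewrite leq_pmulr // muln_gt0 expn_gt0.
  have sW : powS s 1 U <=s W.
    apply: seqS_sub => b u bs Uu; apply: contrapT => nb; apply: h.
    by exists b => // bW; apply/nb/bW.
  have [] // := @len_mono _ _ (addS W (powS s n.+1 U)) U W U.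
    exact: chi_sub.
  exact: fin_powS sW.
have WxU : addS W (mulS x U) <=s U by apply: addS_sub => //; apply: mulS_sub.
have [||c [cP cS]] := IH (addS W (mulS x U)) U => //.
  move=> g; apply: nW.
  apply: (@grows_antidiff _ _ (fun n => chi (addS W (mulS x U)) U n.+1) 0%N); last first.
    apply: (@grows_le _ _ (fun n => chi (addS W (mulS x U)) U (n + 1)%N) 0%N).
      by move=> n _; rewrite addn1.
    exact: grows_addn g.
  move=> n _; have := @chi_mul x W U n 1 WU; rewrite addn1 => h.
  apply: leq_trans (h _) _; first by move=> u Uu; apply: seqS_mem.
  rewrite leq_add2r; apply: chi_quotient => [u Wu|u []//].
  by split; [apply: WU | apply: subZ].
exists (fun i => if i is i'.+1 then c i' else colS W U); split=> [[_|i ik]|[_|i ik]].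
- by split=> // a aV u Uu; apply/VW/aV.
- have [h h'] := cP i ik; split=> // a aV; apply: h' => u Uu; apply/addS_l/VW; exact: aV.
- have [_ h] := cP 0%N isT; split=> [a aW|c0]; first by apply: h => u Uu; apply/addS_l/aW.
  by apply: nPx; apply/c0/h => u Uu; apply: addS_r; exists u.
exact: cS.
Qed.

(** The dimension theorem: the Hilbert-Samuel function of [U / V] has degree
[dim (U / V)]. *)
Lemma growsP k V U : V <=s U -> grows k (chi V U) <-> ~ prime_chain (colS V U) k.
Proof.
move=> VU; split=> [g c|nc]; first exact: grows_no_chain VU c g.
by apply: contrapT => /(chain_of_growth VU).
Qed.

End HilbertSamuel.

(** * Cohomology of a complex modulo powers of the ideal *)

Section ModPowers.
Variables (A : comNzRingType) (m : sub A^o) (s t : seq A).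
Hypothesis loc : local_primary m s t.

Section Differential.
Variables (C C' : lmodType A) (d : {linear C -> C'}) (B : sub C).
Hypotheses (maxC : max_cond C) (maxC' : max_cond C').

Let Z : sub C := preS d (zeroS C').
Let B' : sub C' := imS d (fullS C).
Hypothesis BZ : B <=s Z.

(** The cycles of [C / I ^ n C], pulled back to [C]. *)
Let W n : sub C := preS d (powS s n (fullS C')).

(** The length of the cohomology at [C] of the complex modulo [I ^ n]. *)
Definition coh_len n : nat := len (addS B (powS s n (fullS C))) (W n).

Let full0 (N : lmodType A) (V : sub N) : V <=s fullS N. Proof. by []. Qed.

Let ZW n : addS Z (powS s n (fullS C)) <=s W n.
Proof.
apply: addS_sub => [z /= ->|]; first exact: sub0.
exact: powS_map.
Qed.

Let BZW n : addS B (powS s n (fullS C)) <=s addS Z (powS s n (fullS C)).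
Proof. exact: addSS. Qed.

Let finB n (U : sub C) : fin (addS B (powS s n (fullS C))) U.
Proof.
apply: (fin_powS loc maxC (n := n)); apply: incl_trans (@addS_r _ _ B _).
exact: powSS.
Qed.

(** The length of cohomology is that of [C / (B + I ^ n C)] minus that of the image
[(B' + I ^ n C') / I ^ n C'] of the differential. *)
Lemma coh_len_chi n :
  (coh_len n + chi s (zeroS C') (fullS C') n = chi s B (fullS C) n + chi s B' (fullS C') n)%N.
Proof.
have fW : fin (W n) (fullS C).
  by apply: (fin_powS loc maxC (n := n)); apply: powS_map.
have -> : chi s B (fullS C) n = (coh_len n + len (W n) (fullS C))%N.
  rewrite /chi; have [||||_ ->] := @len_add _ _ (addS B (powS s n (fullS C))) (W n) (fullS C) => //.
  exact: incl_trans (@BZW n) (@ZW n).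
rewrite (chi_exact loc maxC' n (@zeroS_sub _ _ B') (@full0 _ B')) -/(coh_len n) -addnA; congr addn.
congr addn; have [] // := @len_iso _ _ _ d (W n) (fullS C)
  (addS (zeroS C') (powS s n (fullS C'))) (addS B' (powS s n (fullS C'))).
- exact: addSS.
- by move=> x _; apply: addS_l; exists x.
- by move=> x Wx; apply: addS_r.
- by move=> x _ [_ [y [-> Py xE]]]; rewrite /W /= xE add0r.
by apply: addS_sub => [y By|y Py]; [apply: addS_l | apply/addS_r/addS_r].
Qed.

Lemma coh_len_poly : polytype (fun n => (coh_len n)%:R).
Proof.
have p1 := chi_poly loc maxC (@full0 _ B); have p2 := chi_poly loc maxC' (@full0 _ B').
have p3 := chi_poly loc maxC' (@full0 _ (zeroS C')).
apply: (@polytype_ext _ _ 0%N _ (polytypeD (polytypeD p1 p2) (polytypeN p3))) => n _.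
by rewrite -natrD -coh_len_chi natrD addrK.
Qed.

Lemma coh_len_exact n : coh_len n =
  (len (addS B (powS s n (fullS C))) (addS Z (powS s n (fullS C))) +
   len (addS Z (powS s n (fullS C))) (W n))%N.
Proof.
rewrite /coh_len; have [|_ ->] // := len_add (@BZW n) (@ZW n) (@finB n _).
apply: (fin_powS loc maxC (n := n)); apply: incl_trans (@addS_r _ _ Z _); exact: powSS.
Qed.

(** The cycles of [C] contribute [Z / (B + Z :&: I ^ n C)], which is compared to
[Z / (B + I ^ n Z)] by the Artin-Rees lemma. *)
Lemma chi_le_coh_len : exists c, forall n, (chi s B Z n <= coh_len (n + c))%N.
Proof.
have [c cP] := artin_rees maxC s (@full0 _ Z); exists c => n.
rewrite coh_len_exact; apply: leq_trans (leq_addr _ _).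
have [] // := @len_inj _ _ _ idfun (addS B (powS s n Z)) Z
  (addS B (powS s (n + c) (fullS C))) (addS Z (powS s (n + c) (fullS C))).
- by move=> z Zz; apply: addS_l.
move=> z Zz [b [u [Bb Uu zE]]]; exists b, u; split=> //; apply: cP; split=> //.
by apply: (@subDl _ _ _ b); [apply: BZ | rewrite -zE].
Qed.

(** The part of the boundaries in [I ^ n C'] that does not lie in [I ^ n B']. *)
Definition defect n : nat := len (powS s n B') (capS B' (powS s n (fullS C'))).

Let fin_defect n : fin (powS s n B') (capS B' (powS s n (fullS C'))).
Proof. by apply: (fin_powS loc maxC' (n := n)); apply: powSS; apply: capS_l. Qed.

Let defect_sub n : powS s n B' <=s capS B' (powS s n (fullS C')).
Proof. by move=> x Px; split; [apply: powS_le Px | apply: powSS Px]. Qed.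

(** The differential maps the cycles of [C / I ^ n C] onto the module whose length
is the defect. *)
Lemma defect_le n : (defect n <= coh_len n)%N.
Proof.
rewrite coh_len_exact; apply: leq_trans (leq_addl _ _).
have [] // := @len_surj _ _ _ d (addS Z (powS s n (fullS C))) (W n)
  (powS s n B') (capS B' (powS s n (fullS C'))).
- apply: (fin_powS loc maxC (n := n)); apply: incl_trans (@addS_r _ _ Z _); exact: powSS.
- apply: addS_sub => [z /= ->|]; first exact: sub0.
  by apply: powS_map => x _; exists x.
by move=> _ [[x _ ->] Px]; apply: addS_l; exists x.
Qed.

Lemma coh_len_le n : (coh_len n <= chi s B Z n + defect n)%N.
Proof.
rewrite coh_len_exact; apply: leq_add.
  have [] // := @len_surj _ _ _ idfun (addS B (powS s n Z)) Z
    (addS B (powS s n (fullS C))) (addS Z (powS s n (fullS C))).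
  - exact: chi_sub.
  - exact: (fin_chi loc maxC).
  - by apply: addS_sub => [b Bb|u Uu]; [apply: addS_l | apply: addS_r; apply: powSS Uu].
  apply: addS_sub => [z Zz|u Uu]; last by apply/addS_r/addS_r.
  by apply: addS_l; exists z.
have [] // := @len_inj _ _ _ d (addS Z (powS s n (fullS C))) (W n)
  (powS s n B') (capS B' (powS s n (fullS C'))).
  by move=> x Wx; split=> //; exists x.
move=> x _ dx; have [u Uu xE] : imS d (powS s n (fullS C)) (d x).
  by apply: powS_im dx => y [x' _ ->]; exists x'.
by exists (x - u), u; rewrite subrK; split=> //=; rewrite linearB xE subrr.
Qed.

(** By the Artin-Rees lemma the defect is at most the length of
[I ^ (n - c) B' / I ^ n B']. *)
Lemma defect_grows k : grows k.+1 (chi s (zeroS C') B') -> grows k defect.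
Proof.
move=> g; have [c cP] := artin_rees maxC' s (@full0 _ B').
apply: (@grows_addnE _ c).
have VU : zeroS C' <=s B' by apply: zeroS_sub.
apply: (@grows_le _ _ _ 0%N _ (grows_diff c (chi_poly loc maxC' VU) g)) => n _.
have h n' : chi s (zeroS C') B' n' = len (powS s n' B') B'.
  have f1 : fin (powS s n' B') B' by apply: (fin_powS loc maxC' (n := n')).
  have [|||||||_] // := @len_iso _ _ _ idfun (powS s n' B') B' (addS (zeroS C') (powS s n' B')) B'.
  - exact: powS_le.
  - exact: chi_sub.
  - by move=> u Pu; apply: addS_r.
  - by move=> u _ [_ [w [-> Pw /= ->]]]; rewrite add0r.
  by move=> u Bu; apply: addS_l; exists u.
rewrite !h.
suff : (len (powS s n B') B' + defect (n + c) <= len (powS s (n + c) B') B')%N by lia.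
pose D := capS B' (powS s (n + c) (fullS C')).
have fD : fin D B'.
  by apply: (fin_powS loc maxC' (n := n + c)) => x Px; split; [apply: powS_le Px | apply: powSS Px].
have [||||_ ->] := @len_add _ _ (powS s (n + c) B') D B' => //; first exact: capS_l.
rewrite addnC leq_add2l; have [||||_] // := @len_mono _ _ (powS s n B') B' D B'.
  exact: cP.
exact: powS_le.
Qed.

(** A map [f] onto [M] from the cycles [Z'] that sends the boundaries into
[m M] detects the generators of [I ^ n M], up to those of [I ^ n (Z' / B')]. *)
Lemma defect_ge (M : lmodType A) (f : {linear C' -> M}) (Z' : sub C') n :
  max_cond M -> B' <=s Z' -> B' <=s preS f (seqS t (fullS M)) ->
  fullS M <=s imS f Z' ->
  (len (seqS t (powS s n (fullS M))) (powS s n (fullS M)) <= defect n + chi s B' Z' n.+1)%N.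
Proof.
move=> maxM BZ' fB fZ; pose P := powS s n (fullS M); pose D := capS B' (powS s n Z').
pose Q := addS (seqS t P) (imS f D).
have st (N : lmodType A) (U : sub N) : seqS s U <=s seqS t U.
  apply: seqS_sub => b u bs Uu; apply: seqS_scale => //.
  by apply/(lp_gen loc)/(lp_sub loc).
have QP : Q <=s P.
  apply: addS_sub; first exact: seqS_le.
  by move=> _ [u [_ Pu] ->]; apply: (powS_map (f := f)) Pu.
have ftP : fin (seqS t P) P by apply: (fin_powS loc maxM (n := 1)); apply: st.
have f1 : fin (seqS t P) Q by case: (len_mono (@incl_refl _ _ _) (@addS_l _ _ _ _) QP ftP).
have f2 : fin Q P by case: (len_mono (@addS_l _ _ _ _) QP (@incl_refl _ _ _) ftP).
have [|//|//|//|_ ->] := @len_add _ _ (seqS t P) Q P; first exact: addS_l.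
apply: leq_add.
  have h : fin (powS s n B') D /\ (len (powS s n B') D <= defect n)%N.
    apply: len_mono => //.
    - by move=> x Px; split; [apply: powS_le Px | apply: powSS Px].
    - by move=> x [Bx Px]; split=> //; apply: powSS Px.
  apply: leq_trans h.2; have [] // := @len_surj _ _ _ f (powS s n B') D (seqS t P) Q.
  - by move=> x Px; split; [apply: powS_le Px | apply: powSS Px].
  - exact: h.1.
  - apply: incl_trans (powS_map (f := f) fB) _ => x.
    exact: powS_seqS.
  apply: addS_sub; [exact: addS_r | exact: addS_l].
pose V := addS D (powS s n.+1 Z').
have VP : V <=s powS s n Z' by apply: addS_sub; [apply: capS_r | apply: seqS_le].
have fV : fin V (powS s n Z').
  by apply: (fin_powS loc maxC' (n := 1)); apply: incl_trans (@addS_r _ _ D _).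
apply: (@leq_trans (len V (powS s n Z'))).
  have [] // := @len_surj _ _ _ f V (powS s n Z') Q P.
    apply: addS_sub => [x Dx|x Px]; first by apply: addS_r; exists x.
    by apply: addS_l; apply: st; apply: (powS_map (f := f) (n := n.+1)) Px.
  by apply: incl_trans (powS_im fZ) _; apply: addS_l.
have [] // := @len_inj _ _ _ idfun V (powS s n Z') (addS B' (powS s n.+1 Z')) Z'.
- exact: chi_sub.
- exact: (fin_chi loc maxC').
- by move=> u Pu; apply: powS_le Pu.
move=> u Pu [b [y [Bb Py uE]]]; exists b, y; split=> //; split=> //.
have -> : b = u - y by move: uE => /= ->; rewrite addrK.
by apply: subB => //; apply: seqS_le Py.
Qed.


End Differential.
End ModPowers.

(** * Tensor products *)

Section ToPred.
Variables (A : comNzRingType) (V : lmodType A) (U : sub V).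
HB.instance Definition _ := GRing.isSubmodClosed.Build A V (to_pred U)
  (GRing.submod_closed_semi (to_pred_closed U)).
End ToPred.

Section PureTensor.
Variables (A : comNzRingType) (V W : lmodType A).

Lemma pure_tensor_linear (x : V) : linear (@pure_tensor A V W x).
Proof. by move=> a y z; rewrite pure_tensorDr pure_tensorZr. Qed.
HB.instance Definition _ (x : V) := GRing.isLinear.Build A W (tensor V W) _
  (@pure_tensor A V W x) (pure_tensor_linear x).

Definition pure_tensorl (y : W) (x : V) : tensor V W := pure_tensor x y.
Lemma pure_tensorl_linear (y : W) : linear (pure_tensorl y).
Proof. by move=> a x z; rewrite /pure_tensorl pure_tensorDl pure_tensorZl. Qed.
HB.instance Definition _ (y : W) := GRing.isLinear.Build A V (tensor V W) _
  (pure_tensorl y) (pure_tensorl_linear y).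

(** Two maps to the quotient by [Z] that agree on pure tensors are equal. *)
Lemma tensor_gen (Z : sub (tensor V W)) :
  (forall x y, Z (pure_tensor x y)) -> forall u, Z u.
Proof.
move=> Zp u.
pose f : {linear tensor V W -> modquot (to_pred Z)} := @modquot_pi A _ (to_pred Z).
pose z : {linear tensor V W -> modquot (to_pred Z)} := \0.
have f0 : f u = z u.
  apply: tensor_ext => x y; rewrite -[z _](linear0 f).
  by apply/modquot_pi_eq/to_predE; rewrite subr0.
move: f0; rewrite -[z u](linear0 f) => /modquot_pi_eq/to_predE.
by rewrite subr0.
Qed.

Lemma tensor_max_cond : max_cond A^o -> fg_module V -> fg_module W ->
  max_cond (tensor V W).
Proof.
move=> maxA /fg_gen[sV sVP] /fg_gen[sW sWP].
apply: (@gen_max_cond _ _ [seq pure_tensor x y | x <- sV, y <- sW]) => //.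
apply: tensor_gen => x y; set Z := genS _.
have h1 x' : x' \in sV -> genS sW <=s preS (@pure_tensor A V W x') Z.
  move=> xs; apply: genS_sub => y' ys; apply: mem_genS.
  by apply/allpairsP; exists (x', y').
have h2 y' : genS sV <=s preS (pure_tensorl y') Z.
  by apply: genS_sub => x' xs; apply: h1 xs _ (sWP y').
exact: h2 (sVP x).
Qed.

(** The image of [V (x) U] in [V (x) W], as an intersection of submodules. *)
Program Definition tensor_sub (U : sub W) : sub (tensor V W) :=
  @MkSub A (tensor V W) (fun u => forall Z : sub (tensor V W),
    (forall x y, U y -> Z (pure_tensor x y)) -> Z u) _.
Next Obligation.
move=> U; split=> [Z _|a u v hu hv Z hZ]; first exact: sub0.
by apply: subP; [apply: hu | apply: hv].
Qed.

Lemma tensor_sub_powS s n : powS s n (fullS (tensor V W)) <=s tensor_sub (powS s n (fullS W)).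
Proof.
elim: n => [u _ Z hZ|n IH]; first by apply: tensor_gen => x y; apply: hZ.
apply: incl_trans (seqSS IH) _; apply: seqS_sub => b u bs hu Z hZ.
have : preS (GRing.scale b : {linear tensor V W -> tensor V W}) Z u.
  apply: hu => x y Uy /=; rewrite -pure_tensorZr; apply: hZ; exact: seqS_mem.
by [].
Qed.

End PureTensor.

Section TensorQuotient.
Variables (A : comNzRingType) (V W W' : lmodType A) (g : {linear W -> W'}).

Lemma tensor_mapr_bilinear :
  bilinear_map (fun (x : V) (y : W) => pure_tensor x (g y)).
Proof.
split=> [y a x x'|x a y y'].
  by rewrite pure_tensorDl pure_tensorZl.
by rewrite linearP pure_tensorDr pure_tensorZr.
Qed.

(** the map [id_V (x) g] *)
Definition tensor_mapr : {linear tensor V W -> tensor V W'} :=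
  tensor_lift tensor_mapr_bilinear.

Lemma tensor_mapr_pure x y : tensor_mapr (pure_tensor x y) = pure_tensor x (g y).
Proof. exact: tensor_lift_pure. Qed.

Hypothesis gsurj : forall y', exists y, g y = y'.

Lemma tensor_mapr_surj u' : exists u, tensor_mapr u = u'.
Proof.
have [|u _ ->] := @tensor_gen _ _ _ (imS tensor_mapr (fullS _)) _ u'; last by exists u.
move=> x y'; have [y <-] := gsurj y'; exists (pure_tensor x y) => //.
by rewrite tensor_mapr_pure.
Qed.

Variables (s : seq A) (n : nat).
Hypothesis gker : forall y, g y = 0 <-> powS s n (fullS W) y.

(** Right exactness of the tensor product. A map from [V (x) W'] back to the
quotient of [V (x) W] is given by any choice of preimages under [g]. *)
Lemma tensor_mapr_ker u : tensor_mapr u = 0 <-> powS s n (fullS (tensor V W)) u.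
Proof.
pose P := to_pred (powS s n (fullS (tensor V W))).
split=> [u0|].
  have [h hK] := choice gsurj.
  have hP x y y' : g y = g y' -> pure_tensor x y - pure_tensor x y' \in P.
    move=> yy'; apply/to_predE; rewrite -linearB /=.
    have : powS s n (fullS W) (y - y') by apply/gker; rewrite linearB yy' subrr.
    have full : fullS W <=s preS (@pure_tensor A V W x) (fullS (tensor V W)) by [].
    exact: (powS_map full).
  have bil : bilinear_map (fun (x : V) y => modquot_pi P (pure_tensor x (h y))).
    split=> [y a x x'|x a y y'].
      by rewrite pure_tensorDl pure_tensorZl linearP.
    rewrite -linearP -linearP; apply/modquot_pi_eq; apply: hP.
    by rewrite hK linearP !hK.
  pose f := tensor_lift bil.
  have fE : (f \o tensor_mapr) u = modquot_pi P u.
    apply: (@tensor_ext _ _ _ _ (f \o tensor_mapr) (@modquot_pi A _ P)) => x y.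
    transitivity (f (pure_tensor x (g y))); first by congr (f _); apply: tensor_mapr_pure.
    rewrite tensor_lift_pure; by apply/modquot_pi_eq; apply: hP; rewrite hK.
  have {}fE : f (tensor_mapr u) = modquot_pi P u := fE.
  move: fE; rewrite u0 linear0 => /esym; rewrite -[RHS](linear0 (@modquot_pi A _ P)).
  by move/modquot_pi_eq/to_predE; rewrite subr0.
move=> Pu; have full : fullS (tensor V W) <=s preS tensor_mapr (fullS _) by [].
have Pu' : powS s n (fullS (tensor V W')) (tensor_mapr u) by apply: (powS_map full).
apply: (tensor_sub_powS Pu' (Z := zeroS _)) => x y' Py'.
have full' : fullS W' <=s imS g (fullS W) by move=> z _; have [y <-] := gsurj z; exists y.
have [y /gker -> ->] : imS g (powS s n (fullS W)) y' by apply: (powS_im full').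
by rewrite /= linear0.
Qed.
End TensorQuotient.

(** * Powers of an ideal and of its generators *)

Section IdealGenerators.
Variables (A : comNzRingType) (I : {pred A}) (s : seq A).
Hypothesis sI : forall a : A, a \in I <-> seqS s (fullS A^o) a.

Lemma span_sub_pred (V : lmodType A) (S : set V) (U : sub V) x :
  (forall y, S y -> U y) -> x \in Defs.span S -> U x.
Proof.
move=> SU /asboolP /(_ (to_pred U) (to_pred_closed U)) h; apply/to_predE/h.
by move=> y /SU /to_predE.
Qed.

Lemma smul_pred (V : lmodType A) (J : {pred A}) (U : {pred V}) : submod_closed (smul J U).
Proof. by apply: GRing.subsemimod_closed_submod; apply: span_submod. Qed.

Lemma ideal_powE n (a : A) : a \in ideal_pow I n <-> powS s n (fullS A^o) a.
Proof.
elim: n a => [|n IH] a //=; split.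
  apply: span_sub_pred => y [b [x [/sI bI xn ->]]].
  by apply: seqS_scale => //; apply/IH.
apply: (@seqS_sub A A^o s (powS s n (fullS A^o))
  (of_pred (smul_pred I (ideal_pow I n : {pred A^o})))) => b u bs Pu /=.
apply: Defs.sub_span; exists b, u; split=> //; last exact/IH.
by apply/sI; rewrite -[b]mulr1; apply: (@seqS_mem A A^o s b (fullS A^o) (1 : A)).
Qed.

Lemma smul_ideal_powE n (M : lmodType A) (x : M) :
  x \in smul (ideal_pow I n) predT <-> powS s n (fullS M) x.
Proof.
split.
  apply: span_sub_pred => _ [a [u [/ideal_powE an _ ->]]].
  have h : powS s n (fullS A^o) <=s colS (powS s n (fullS M)) (fullS M).
    elim: n {an} => // n IH; apply: seqS_sub => b c bs /IH cn v Fv.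
    rewrite -scalerA; apply: seqS_mem => //; exact: cn.
  exact: h.
elim: n x => [|n IH] x; first by move=> _; apply: Defs.sub_span; exists 1, x; rewrite scale1r.
pose P : sub M := of_pred (smul_pred (ideal_pow I n.+1) predT).
apply: (@seqS_sub A M s (powS s n (fullS M)) P) => b u bs /IH.
apply: (@span_sub_pred _ _ (preS (GRing.scale b : {linear M -> M}) P)).
move=> _ [a [v [an _ ->]]] /=; apply: Defs.sub_span; exists (b * a), v; split=> //.
  apply: Defs.sub_span; exists b, a; split=> //; apply/sI; rewrite -[b]mulr1.
  exact: (@seqS_mem A A^o s b (fullS A^o) (1 : A)).
by rewrite scalerA.
Qed.

End IdealGenerators.

(** * Length, dimension and degree as suprema *)

(** Over the rational numbers a set of extended numbers need not have a supremum.
A set of natural numbers has one: its maximum, or [+oo] if it is unbounded. *)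
Lemma sup_nat_ub (P : set nat) k : P k -> (k%:R%:E <= sup_nat P)%E.
Proof.
move=> Pk; rewrite /sup_nat /ereal_sup; set S := (X in supremum _ X).
have Sk : S (k%:R)%:E by exists k.
apply: ge_supremum_Nmem (Sk).
have [[n Pn]|unb] := pselect (exists n, forall j, P j -> (j <= n)%N).
  have [j [Pj jmax]] : exists j, P j /\ forall i, P i -> (i <= j)%N.
    elim: n Pn => [|n IH] Pn.
      by exists k; split=> // i /Pn; rewrite leqn0 => /eqP ->.
    have [Pn1|nPn1] := pselect (P n.+1); first by exists n.+1.
    apply: IH => i Pi; rewrite -ltnS ltn_neqAle Pn // andbT.
    by apply/eqP => iE; apply: nPn1; rewrite -iE.
  exists (j%:R)%:E; split=> [_ [i Pi <-]|y]; first by rewrite lee_fin ler_nat jmax.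
  by apply; exists j.
exists +oo%E; split=> [y _|[y|//|] yub]; first exact: leey.
  case: unb; exists (Num.bound `|y|) => j Pj.
  have := yub (j%:R)%:E (ex_intro2 _ _ j Pj erefl); rewrite lee_fin => jy.
  rewrite -(ler_nat rat); apply: le_trans jy _; apply: le_trans (ler_norm y) _.
  exact/ltW/archi_boundP.
by have := yub _ Sk.
Qed.

Lemma sup_nat_le (P : set nat) x : (forall j, P j -> (j%:R%:E <= x)%E) -> (sup_nat P <= x)%E.
Proof.
move=> Px; rewrite /sup_nat /ereal_sup /supremum; case: ifP => _; first exact: leNye.
case: xgetP => [y _ [_ ymin]|_]; last exact: leNye.
by apply: ymin => _ [j /Px h <-].
Qed.

Lemma sup_nat_max (P : set nat) k : P k -> (forall j, P j -> (j <= k)%N) ->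
  sup_nat P = (k%:R)%:E.
Proof.
move=> Pk kmax; apply/eqP; rewrite eq_le sup_nat_ub // andbT.
by apply: sup_nat_le => j /kmax; rewrite lee_fin ler_nat.
Qed.

Lemma sup_nat_lt (P : set nat) k : (sup_nat P < k%:R%:E)%E <-> forall j, P j -> (j < k)%N.
Proof.
split=> [Pk j /sup_nat_ub Pj|Pk].
  by have := le_lt_trans Pj Pk; rewrite lte_fin ltr_nat.
case: k Pk => [|k] Pk.
  apply: (@le_lt_trans _ _ -oo%E); last exact: ltNyr.
  by apply: sup_nat_le => j /Pk.
apply: (@le_lt_trans _ _ (k%:R)%:E); last by rewrite lte_fin ltr_nat.
by apply: sup_nat_le => j /Pk; rewrite lee_fin ler_nat.
Qed.

Lemma pred_subs (A : comNzRingType) (N : lmodType A) (c : nat -> {pred N}) :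
  exists c' : nat -> sub N, forall i, submod_closed (c i) -> forall x, c' i x <-> x \in c i.
Proof.
have h i : exists P : sub N, submod_closed (c i) -> forall x, P x <-> x \in c i.
  have [ci|nci] := pselect (submod_closed (c i)); last by exists (zeroS N).
  by exists (of_pred ci).
by have [c' c'P] := choice h; exists c'.
Qed.

Section Invariants.
Variables (A : comNzRingType) (N : lmodType A).

Lemma chain_pred k : chain (zeroS N) (fullS N) k <->
  exists c : nat -> {pred N}, (forall i, (i <= k)%N -> submod_closed (c i)) /\
    strictly_increasing k c.
Proof.
split=> [[c [_ _ cS]]|[c [cP cS]]].
  exists (fun i => to_pred (c i)); split=> [i _|i ik]; first exact: to_pred_closed.
  have [ci nci] := cS i ik; split=> [x /to_predE/ci/to_predE //|].
  apply: contrapT => h; apply: nci => x cx; apply: contrapT => nx; apply: h.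
  by exists x; [apply/to_predE | apply/negP => /to_predE].
have [c' c'E] := pred_subs c; exists c'; split=> // i ik.
have E := c'E i (cP i (ltnW ik)); have E' := c'E i.+1 (cP i.+1 ik).
have [ci [x cx nx]] := cS i ik; split=> [y /E/ci/E' //|h].
by move/negP: nx; apply; apply/E/h/E'.
Qed.

Lemma length_len : fin (zeroS N) (fullS N) ->
  Defs.length N = ((len (zeroS N) (fullS N))%:R)%:E.
Proof.
move=> f; have [cl lmax] := lenP (@zeroS_sub _ _ (fullS N)) f.
by apply: sup_nat_max => [|j]; [apply/chain_pred | move/chain_pred/lmax].
Qed.

Lemma ideal_submod (P : {pred A}) : idealr_closed P -> submod_closed (P : {pred A^o}).
Proof. by case=> P0 _ Pl; split=> // a x y Px Py; apply: Pl. Qed.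

Lemma krull_dimP k :
  (krull_dim N < k%:R%:E)%E <-> ~ prime_chain (colS (zeroS N) (fullS N)) k.
Proof.
have annE a : a \in annihilator N <-> colS (zeroS N) (fullS N) a.
  by split=> [/asboolP h u _|h]; [apply: h | apply/asboolP => x; apply: h].
rewrite /krull_dim sup_nat_lt; split=> [lt [c [cP cS]]|nc j [c [cP cS]]].
  suff /lt : exists c : nat -> {pred A},
      (forall i, (i <= k)%N -> prime_ideal (c i) /\ {subset annihilator N <= c i}) /\
      strictly_increasing k c by rewrite ltnn.
  exists (fun i => to_pred (c i)); split=> [i ik|i ik].
    have [[n1 pr] J] := cP i ik; split; last by move=> a /annE /J /to_predE.
    split; first split.
    - by apply/to_predE; apply: id0.
    - by apply/negP => /to_predE.
    - by move=> a x y /to_predE cx /to_predE cy; apply/to_predE; apply: idD => //; apply: idM.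
    move=> u v /to_predE/pr[cu|cv]; apply/orP; [left|right]; exact/to_predE.
  have [ci nci] := cS i ik; split=> [x /to_predE/ci/to_predE //|].
  apply: contrapT => h; apply: nci => x cx; apply: contrapT => nx; apply: h.
  by exists x; [apply/to_predE | apply/negP => /to_predE].
rewrite ltnNge; apply/negP => kj; apply: nc.
have [c' c'E] := @pred_subs A A^o c.
have E i : (i <= k)%N -> forall x, c' i x <-> x \in c i.
  by move=> ik; apply: c'E; apply: ideal_submod; have [[]] := cP i (leq_trans ik kj).
exists c'; split=> i ik.
  have [[[_ n1 _] pr] J] := cP i (leq_trans ik kj); have Ei := E i ik.
  split; last by move=> a /annE/J/Ei.
  split=> [/Ei|a b /Ei/pr/orP[ca|cb]]; first exact/negP.
    by left; apply/Ei.
  by right; apply/Ei.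
have Ei := E i (ltnW ik); have Ei' := E i.+1 ik.
have [ci [x cx nx]] := cS i (leq_trans ik kj); split=> [y /Ei/ci/Ei' //|h].
by move/negP: nx; apply; apply/Ei/h/Ei'.
Qed.

End Invariants.


Lemma prime_chain_mono (A : comNzRingType) (J J' : sub A^o) k :
  J <=s J' -> prime_chain J' k -> prime_chain J k.
Proof.
move=> JJ [c [cP cS]]; exists c; split=> // i ik; have [h h'] := cP i ik.
by split=> //; apply: incl_trans JJ h'.
Qed.

(** The smallest prime of the chain contains the intersection of the [J i], hence
one of them. *)
Lemma prime_chain_inter (A : comNzRingType) (I : eqType) (r : seq I)
    (J : I -> sub A^o) (J0 : sub A^o) k :
  (forall a, (forall i, i \in r -> J i a) -> J0 a) -> prime_chain J0 k ->
  exists i, prime_chain (J i) k.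
Proof.
move=> JJ0 [c [cP cS]]; have [[n1 pr] J0c] := cP 0%N isT.
have [i ic] : exists i, J i <=s c 0%N.
  apply: contrapT => noi.
  have [a [nca aJ]] : exists a, ~ c 0%N a /\ forall i, i \in r -> J i a.
    elim: r {JJ0} => [|i r [a [nca aJ]]]; first by exists (1 : A).
    have [b Jb ncb] : exists2 b, J i b & ~ c 0%N b.
      apply: contrapT => h; apply: noi; exists i => b Jb; apply: contrapT => nb.
      by apply: h; exists b.
    exists ((b : A) * (a : A)); split=> [/pr[]//|j]; rewrite inE => /orP[/eqP ->|jr].
      exact: idMr.
    by apply: idM; apply: aJ.
  by apply: nca; apply: J0c; apply: JJ0.
exists i, c; split=> // j jk; have [h _] := cP j jk; split=> //.
elim: j jk {h} => // j IH jk; apply: incl_trans (IH (ltnW jk)) _.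
by case: (cS j jk).
Qed.

(** * Noetherian local rings *)

Lemma genS_seqS (A : comNzRingType) (s : seq A) a :
  @genS A A^o s a <-> seqS s (fullS A^o) a.
Proof.
split.
  apply: (@genS_sub A A^o) => b bs; rewrite -[b]mulr1.
  exact: (@seqS_mem A A^o s b (fullS A^o) (1 : A)).
apply: (@seqS_sub A A^o) => b u bs _.
have -> : b *: u = (u : A) *: (b : A^o) by rewrite /GRing.scale /= mulrC.
by apply: subZ; apply: mem_genS.
Qed.

Lemma noetherian_seqS (A : comNzRingType) (J : {pred A}) : noetherian A ->
  idealr_closed J -> exists s : seq A, forall a : A, a \in J <-> seqS s (fullS A^o) a.
Proof.
move=> noethA /ideal_submod /noethA[s sJ]; exists s => a.
by split=> [aJ|/genS_seqS/span_genS]; [apply/genS_seqS/span_genS; rewrite -sJ | rewrite -sJ].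
Qed.

(** A non-unit generates a proper ideal, and by the maximum condition that lies in
a maximal ideal, which is [m]. *)
Lemma local_primary_of (A : comNzRingType) (m I : {pred A}) :
  noetherian A -> local_ring m -> m_primary m I ->
  exists (m' : sub A^o) (s t : seq A), local_primary m' s t /\
    forall a : A, a \in I <-> seqS s (fullS A^o) a.
Proof.
move=> noethA [[mid mmax] muniq] [[Iid _] mI].
have maxA := noetherian_max_cond noethA.
have [s sI] := noetherian_seqS noethA Iid.
have [t tm] := noetherian_seqS noethA mid.
exists (of_pred (ideal_submod mid)), s, t; split=> //; split=> //.
- by have [_ /negP n1 _] := mid.
- move=> a /= nma; apply: contrapT => nob.
  have [|D [nD1 Da] Dmax] := maxA (fun D => ~ D (1 : A) /\ D a).
    exists (lineS (fullS A^o) (a : A^o)); split; last exact: lineS_gen.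
    by case=> b _ bE; apply: nob; exists b; rewrite bE.
  have Dmax' : @maximal_ideal A (to_pred D).
    have DE x : x \in to_pred D <-> D x := to_predE D x.
    split.
      split; [by apply/DE; apply: id0 | by apply/negP => /DE |].
      by move=> b x y /DE Dx /DE Dy; apply/DE; apply: idD => //; apply: idM.
    move=> J Jid DJ; have [_ nJ1 _] := Jid => x; apply/idP/idP => [Jx|/DJ //].
    suff h : of_pred (ideal_submod Jid) <=s D by apply/DE/h.
    apply: Dmax => /=.
      by split; [exact/negP | apply/DJ/DE].
    by move=> y Dy; apply/DJ/DE.
  by apply: nma; rewrite -(muniq _ Dmax'); apply/to_predE.
- by move=> b bs; apply/mI; exists 1%N; rewrite expr1; apply/sI;
    rewrite -[b]mulr1; apply: (@seqS_mem A A^o s b (fullS A^o) (1 : A)).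
by move=> a /mI[e ae]; exists e; apply/sI.
Qed.

(** * Cohomology as a subquotient *)

Section Cohomology.
Variable A : comNzRingType.
Implicit Types (X Y : complex A).

Definition cyc Y i : sub (Y i) := preS (diff Y i (i + 1)) (zeroS (Y (i + 1))).
Definition bnd Y i : sub (Y i) := imS (diff Y (i - 1) i) (fullS (Y (i - 1))).

Lemma bnd_cyc Y i : bnd Y i <=s cyc Y i.
Proof. by move=> _ [x _ ->] /=; rewrite diff_diff. Qed.

Lemma mem_cycles Y i x : x \in cycles Y i <-> cyc Y i x.
Proof. by split=> /eqP. Qed.

Lemma mem_boundaries Y i x : x \in boundaries Y i <-> bnd Y i x.
Proof. by split=> [/asboolP[y ->]|[y _ ->]]; [exists y | apply/asboolP; exists y]. Qed.

Section OneDegree.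
Variables (Y : complex A) (i : int).
Let S := submod (cycles Y i).
Let v : {linear S -> Y i} := val.
Let P : submodClosed S := preim_submod v (boundaries Y i).

Lemma cohomology_len : fin (bnd Y i) (cyc Y i) ->
  Defs.length (cohomology Y i) = ((len (bnd Y i) (cyc Y i))%:R)%:E.
Proof.
move=> f; pose V := preS v (bnd Y i).
have [fV le1] : fin V (fullS S) /\ (len V (fullS S) <= len (bnd Y i) (cyc Y i))%N.
  apply: (@len_inj _ _ _ v) => //; first exact: bnd_cyc.
  by move=> u _; apply/mem_cycles; apply: (valP u).
have [|||||||_ ->] := @len_iso _ _ _ v V (fullS S) (bnd Y i) (cyc Y i) => //.
- exact: bnd_cyc.
- by move=> u _; apply/mem_cycles; apply: (valP u).
- move=> x /mem_cycles xc; apply: addS_l; exists (@Submod _ _ (cycles Y i) x xc) => //.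
pose q : {linear S -> modquot P} := @modquot_pi A S P.
have [|||||||] // := @len_iso _ _ _ q V (fullS S) (zeroS (modquot P)) (fullS (modquot P)).
- move=> u Vu /=; rewrite -(linear0 q); apply/modquot_pi_eq; rewrite subr0.
  exact/mem_boundaries.
- move=> u _ /=; rewrite -(linear0 q) => /modquot_pi_eq; rewrite subr0.
  by move/mem_boundaries.
- by move=> x _; apply: addS_l; exists (modquot_repr x) => //; apply: (esym (modquot_reprK x)).
by move=> f' <-; apply: length_len.
Qed.

Lemma annihilator_cohomology a :
  (forall x : cohomology Y i, a *: x = 0) <-> colS (bnd Y i) (cyc Y i) a.
Proof.
pose q : {linear S -> modquot P} := @modquot_pi A S P.
split=> [h x /mem_cycles xc|h x].
  have := h (q (@Submod _ _ (cycles Y i) x xc)); rewrite -linearZ -(linear0 q).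
  move/modquot_pi_eq; rewrite subr0 => hb; apply/mem_boundaries.
  exact: hb.
rewrite -[x]modquot_reprK -[LHS](linearZ_LR q) -(linear0 q); apply/modquot_pi_eq.
rewrite subr0; have /mem_cycles/h hb := valP (modquot_repr x).
by apply/mem_boundaries.
Qed.

End OneDegree.

(** The annihilator of the total cohomology is the intersection of those of its
summands, of which finitely many are non-zero. *)
Lemma total_dim_lt Y k (r : seq int) :
  (forall i (x : Y i), i \notin r -> x = 0) ->
  (krull_dim (total_cohomology Y) < k%:R%:E)%E <->
  forall i, ~ prime_chain (colS (bnd Y i) (cyc Y i)) k.
Proof.
move=> rP; rewrite krull_dimP.
have annE a : colS (zeroS (total_cohomology Y)) (fullS (total_cohomology Y)) a <->
    forall i, colS (bnd Y i) (cyc Y i) a.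
  split=> [h i|h u _].
    apply/annihilator_cohomology => x.
    have := h (dsum_in x) I => /(congr1 (fun u : dsum (cohomology Y) => u i)).
    by rewrite dsumZE /= dfwith_in.
  apply: dsumP => i; rewrite dsumZE dsum0E.
  by move: (u i); apply/annihilator_cohomology.
split=> [nc i c|nc c].
  by apply: nc; apply: prime_chain_mono c => a /annE.
have [|i] := @prime_chain_inter A _ r (fun i => colS (bnd Y i) (cyc Y i)) _ k _ c; last exact: nc.
move=> a ar; apply/annE => i; have [/ar //|ir] := boolP (i \in r).
by move=> u _; rewrite (rP i u ir) scaler0; apply: sub0.
Qed.

End Cohomology.

(** * The complex [X (x) M] modulo powers of the ideal *)

Section TensorComplex.
Variables (A : comNzRingType) (m : sub A^o) (s t : seq A) (I : {pred A}).
Hypotheses (loc : local_primary m s t) (sI : forall a : A, a \in I <-> seqS s (fullS A^o) a).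
Variables (X : complex A) (M : lmodType A).
Hypotheses (Xfg : forall i, fg_module (X i)) (Mfg : fg_module M).

Let C : complex A := tensor_complex X M.

Lemma tensor_complex_max i : max_cond (C i).
Proof. exact: tensor_max_cond (lp_max loc) (Xfg i) Mfg. Qed.

(** By right exactness [X (x) (M / I ^ n M)] is [C / I ^ n C], so that its cycles and
boundaries can be pulled back to [C]. *)
Lemma cohomology_mod_pow i n :
  Defs.length (cohomology (tensor_complex X (mod_pow I M n)) i) =
  ((coh_len s (diff C i (i + 1)) (bnd C i) n)%:R)%:E.
Proof.
set Y := tensor_complex X (mod_pow I M n).
pose g : {linear M -> mod_pow I M n} := @modquot_pi A M (smul (ideal_pow I n) predT).
have gsurj y' : exists y, g y = y' by exists (modquot_repr y'); apply: modquot_reprK.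
have gker y : g y = 0 <-> powS s n (fullS M) y.
  rewrite -(linear0 g); split=> [/modquot_pi_eq|h].
    by rewrite subr0 => /(smul_ideal_powE sI).
  by apply/modquot_pi_eq; rewrite subr0; apply/(smul_ideal_powE sI).
pose q j : {linear C j -> Y j} := tensor_mapr (X j) g.
have qsurj j y : exists x, q j x = y by apply: tensor_mapr_surj.
have qker j x : q j x = 0 <-> powS s n (fullS (C j)) x by apply: tensor_mapr_ker.
have qdiff j k x : q k (diff C j k x) = diff Y j k (q j x).
  apply: (@tensor_ext _ _ _ _ (q k \o diff C j k) (diff Y j k \o q j)) => u y /=.
  transitivity (q k (pure_tensor (diff X j k u) y)).
    by congr (q k _); apply: tensor_map_pure.
  transitivity (diff Y j k (pure_tensor u (g y))); last first.
    by congr (diff Y j k _); apply/esym/tensor_mapr_pure.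
  by rewrite /q tensor_mapr_pure; apply/esym/tensor_map_pure.
have [|||||||f lE] := @len_iso _ _ _ (q i) (addS (bnd C i) (powS s n (fullS (C i))))
  (preS (diff C i (i + 1)) (powS s n (fullS (C (i + 1))))) (bnd Y i) (cyc Y i).
- apply: addS_sub; last by apply: powS_map.
  by apply: incl_trans (@bnd_cyc _ C i) _ => x /= ->; apply: sub0.
- exact: bnd_cyc.
- apply: (fin_powS loc (@tensor_complex_max i) (n := n)).
  by apply: incl_trans (@addS_r _ _ (bnd C i) _); apply: powSS.
- by move=> x /= /qker; rewrite qdiff.
- apply: addS_sub => [_ [x _ ->]|x /qker qx].
    change (bnd Y i (q i (diff C (i - 1) i x))).
    by rewrite qdiff; exists (q (i - 1) x).
  by change (bnd Y i (q i x)); rewrite qx; apply: sub0.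
- move=> x _ [y _]; have [c <-] := qsurj _ y; rewrite -qdiff => xE.
  exists (diff C (i - 1) i c), (x - diff C (i - 1) i c); split; first by exists c.
    by apply/qker; rewrite linearB xE subrr.
  by rewrite addrC subrK.
- move=> y; have [x <-] := qsurj _ y => dx; apply: addS_l; exists x => //=.
  by apply/qker; rewrite qdiff.
by rewrite (cohomology_len f) lE.
Qed.

End TensorComplex.

(** * Non-contractible complexes *)

(** An idempotent [p] of a projective module [P] lifts along any [q] with the same
image. As [q] need not be onto, it is completed by [1 - p] to a surjection from
[K * P]. *)
Section ProjectiveLift.
Variables (A : comNzRingType) (P K : lmodType A).
Variables (p : {linear P -> P}) (q : {linear K -> P}).

Definition lift_cover (u : K * P) : P := q u.1 + (u.2 - p u.2).

Lemma lift_cover_linear : linear lift_cover.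
Proof.
move=> a u v; rewrite /lift_cover /= [q _]linearP [p _]linearP scalerDr scalerBr.
by rewrite [RHS]addrACA opprD; congr (_ + _); rewrite addrACA.
Qed.

HB.instance Definition _ := GRing.isLinear.Build A (K * P)%type P _
  lift_cover lift_cover_linear.

Lemma projective_lift : projective P ->
  (forall x, p (p x) = p x) -> (forall y, p (q y) = q y) ->
  (forall x, exists y, p x = q y) ->
  exists g : {linear P -> K}, forall x, q (g x) = p x.
Proof.
move=> projP pp pq qsurj.
have [|g gP] := projP _ _ (lift_cover : {linear (K * P)%type -> P}) p.
  move=> x; have [y xy] := qsurj x; exists (y, x).
  by rewrite /= /lift_cover /= -xy addrC subrK.
exists (fst \o g) => x; have := congr1 p (gP x).
by rewrite pp /= /lift_cover linearD linearB pp subrr addr0 pq.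
Qed.
End ProjectiveLift.

Section Contractible.
Variables (A : comNzRingType) (X : complex A).
Hypotheses (Xbnd : bounded X) (Xproj : forall i, projective (X i)).

(** The homotopy equation, with the sign of a homotopy from the zero map. *)
Definition contracting (h : forall i j, {linear X i -> X j}) (i : int) : Prop :=
  forall x : X i, 0 - x = diff X (i - 1) i (h i (i - 1) x) +
                          h (i + 1) i (diff X i (i + 1) x).

Lemma contractible_zero h : (forall i, contracting h i) ->
  homotopy_equivalent X (zero_complex A).
Proof.
move=> hc.
exists (@CochainMap _ X (zero_complex A) (fun i => \0) (fun i j x => erefl)).
have z0 i j (x : zero_complex A i) :
    (\0 : {linear zero_complex A j -> X j}) (diff (zero_complex A) i j x) =
    diff X i j ((\0 : {linear zero_complex A i -> X i}) x).
  by rewrite /= linear0.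
exists (@CochainMap _ (zero_complex A) X (fun i => \0) z0); split.
  by exists h => i x; apply: hc.
exists (fun i j => \0) => i y; apply/matrixP => ? [].
  by [].
Qed.

(** A null-homotopy of the identity is built by descending induction on the
degree. Once it exists above [i], the map [p = 1 + h d], where [h] satisfies the
homotopy equation with the sign of [contracting], is a projection onto the
cycles of [X_i]. If all cycles are boundaries then [p] lifts along the
differential, which gives the next component of [h]; so this fails for some
[i], as [X] is not contractible. *)
Lemma cycle_not_boundary : ~ homotopy_equivalent X (zero_complex A) ->
  exists i, ~ cyc X i <=s bnd X i /\ exists p : {linear X i -> X i},
    (forall x, cyc X i (p x)) /\ (forall x, cyc X i x -> p x = x).
Proof.
move=> nX; apply: contrapT => nofail; apply: nX.
have [n Xn] := Xbnd.
suff [h hc] : exists h, forall i, (- (n%:Z) - 1 < i)%R -> contracting h i.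
  apply: (@contractible_zero h) => i; have [/hc //|ni] := ltP (- (n%:Z) - 1) i.
  move=> x; have -> : x = 0 by apply: Xn; lia.
  by rewrite !linear0.
have : forall k : nat, exists h, forall i, (n%:Z - k%:Z < i)%R -> contracting h i.
  elim=> [|k [h hc]].
    exists (fun i j => \0) => i ni x; have -> : x = 0 by apply: Xn; lia.
    by rewrite !linear0.
  pose j : int := n%:Z - k%:Z.
  pose p : {linear X j -> X j} := idfun \+ (h (j + 1) j \o diff X j (j + 1)).
  have pE x : p x = x + h (j + 1) j (diff X j (j + 1) x) by [].
  have pc x : cyc X j (p x).
    have j1 : (n%:Z - k%:Z < j + 1)%R by rewrite ltrDl.
    have := hc (j + 1) j1 (diff X j (j + 1) x); rewrite addrK diff_diff linear0 addr0.
    by rewrite sub0r /= linearD /= => <-; rewrite subrr.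
  have pz x : cyc X j x -> p x = x by move=> xc; rewrite pE xc linear0 addr0.
  have [zb|nzb] := pselect (cyc X j <=s bnd X j); last first.
    by case: nofail; exists j; split=> //; exists p.
  have [|||g gP] := @projective_lift _ _ _ p (diff X (j - 1) j) (@Xproj j).
  - by move=> x; apply: pz.
  - by move=> y; apply: pz; apply: bnd_cyc; exists y.
  - by move=> x; have [y _ ->] := zb _ (pc x); exists y.
  pose T (ij : int * int) := {linear X ij.1 -> X ij.2}.
  pose h' := dfwith (fun ij : int * int => h ij.1 ij.2 : T ij)
    ((\- g : {linear X j -> X (j - 1)}) : T (j, j - 1)).
  have h'j : h' (j, j - 1) = \- g by apply: dfwith_in.
  have h'E i l : i != j -> h' (i, l) = h i l.
    move=> ij; rewrite /h' dfwith_out //=.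
    by apply: contraNneq ij => -[->].
  (* only the component of degree j has changed *)
  exists (fun i l => h' (i, l)) => i ni x.
  have [iE|ij] := eqVneq i j.
    move: x; rewrite iE => x; rewrite h'j h'E; last by rewrite -subr_eq0 addrC addKr oner_eq0.
    by rewrite /= linearN gP pE sub0r opprD subrK.
  have ji : (n%:Z - k%:Z < i)%R by move: ni ij; rewrite /j; lia.
  by rewrite !h'E //; [apply: hc | lia].
move=> /(_ (n + n).+1)[h hc]; exists h => i ni; apply: hc.
by apply: le_lt_trans ni; lia.
Qed.
End Contractible.

(** * A functional that separates a cycle from the boundaries *)

Section CycleFunctional.
Variables (A : comNzRingType) (m : sub A^o) (s t : seq A).
Hypothesis loc : local_primary m s t.
Variables (P : lmodType A) (B Z : sub P) (p : {linear P -> P}).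
Hypotheses (maxP : max_cond P) (projP : projective P).
Hypotheses (BZ : B <=s Z) (ZB : ~ Z <=s B).
Hypotheses (pZ : forall x, Z (p x)) (pid : forall x, Z x -> p x = x).

(** For a maximal submodule [W] of [Z] over [B], [Z / W] is isomorphic to [A / m].
The functional lifts the resulting map [Z -> A / m], extended to [P] by [p], along
[A -> A / m]; concretely, [p x] is congruent to [phi x *: z] modulo [W]. *)
Lemma cycle_functional : exists phi : {linear P -> A^o},
  (forall x, B x -> m (phi x)) /\ exists z (u : A), Z z /\ u * (phi z : A) = 1.
Proof.
have [|W [BW WZ nZW] Wmax] := maxP (F := fun W => [/\ B <=s W, W <=s Z & ~ Z <=s W]).
  by exists B.
have [z Zz nWz] : exists2 z, Z z & ~ W z.
  apply: contrapT => h; apply: nZW => x Zx; apply: contrapT => nx; apply: h.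
  by exists x.
have ZWz : Z <=s addS W (lineS (fullS A^o) z).
  apply: contrapT => nZ; apply: nWz; apply: (Wmax (addS W (lineS (fullS A^o) z))) => //.
    split=> //; first by apply: incl_trans BW _; exact: addS_l.
    by apply: addS_sub => //; apply: lineS_sub.
  by apply: addS_r; apply: lineS_gen.
pose K := (A^o * submod (to_pred W))%type.
pose qf (u : K) : P := (u.1 : A) *: z + val u.2.
have qlin : linear qf.
  by move=> a u v; rewrite /qf /= scalerDl scalerDr scalerA addrACA.
pose q : {linear K -> P} := HB.pack qf (GRing.isLinear.Build A K P _ qf qlin).
have qE u : q u = (u.1 : A) *: z + val u.2 by [].
have valW (u : submod (to_pred W)) : W (val u) by apply/to_predE; apply: (valP u).
have [|||g gP] := @projective_lift _ _ _ p q projP.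
- by move=> x; apply/pid/pZ.
- move=> u; apply: pid; rewrite qE; apply: subD; first exact: subZ.
  exact/WZ/valW.
- move=> x; have [w [_ [Ww [a _ ->] xE]]] := ZWz _ (pZ x).
  have wp : w \in to_pred W by apply/to_predE.
  by exists (a, Submod wp); rewrite qE /= addrC.
have gE x : (g x).1 *: z = p x - val (g x).2 by rewrite -gP qE addrK.
have mW (a : A) : W (a *: z) -> m a.
  move=> Wa; apply: contrapT => /(lp_unit loc)[b ba]; apply: nWz.
  by rewrite -[z]scale1r -ba -scalerA; apply: subZ.
exists (fst \o g); split=> [x Bx|].
  apply: mW; rewrite gE pid; last exact: BZ.
  by apply: subB => //; apply: BW.
have [u uE] : exists u : A, u * (g z).1 = 1.
  apply: (lp_unit loc) => mg; apply: (lp_proper loc).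
  rewrite -(subrK ((g z).1 : A) 1); apply: idD => //; apply: mW.
  by rewrite scalerBl scale1r gE pid // opprB addrC subrK.
by exists z, u.
Qed.
End CycleFunctional.

(** * Growth of the cohomology modulo powers *)

Section BoundedProjective.
Variables (A : comNzRingType) (m : sub A^o) (s t : seq A).
Hypothesis loc : local_primary m s t.
Variables (X : complex A) (M : lmodType A).
Hypotheses (Mfg : fg_module M) (XK : in_Kb_proj X).
Let Xbnd := XK.1.
Let Xfg i : fg_module (X i) := (XK.2 i).1.
Let Xproj i : projective (X i) := (XK.2 i).2.
Let C : complex A := tensor_complex X M.
Let maxC i : max_cond (C i) := tensor_complex_max loc Xfg Mfg (i := i).
Let maxM : max_cond M.
Proof. by have [g gP] := fg_gen Mfg; apply: gen_max_cond (lp_max loc) gP. Qed.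

Definition complex_coh_len i : nat -> nat := coh_len s (diff C i (i + 1)) (bnd C i).


Lemma complex_coh_len_poly i : polytype (fun n => (complex_coh_len i n)%:R).
Proof.
exact: (coh_len_poly loc (maxC (i := i)) (maxC (i := i + 1)) (@bnd_cyc _ C i)).
Qed.

Let MZ : zeroS M <=s fullS M. Proof. by []. Qed.

(** The functional of [cycle_functional], tensored with [M], shows that a bound on
the cohomology modulo [I ^ n] is one on the length of [I ^ n M / m I ^ n M], hence
on the differences of the Hilbert-Samuel function of [M]. *)
Lemma complex_coh_len_grows_module k : ~ homotopy_equivalent X (zero_complex A) ->
  (forall i, grows k (complex_coh_len i)) -> grows k.+1 (chi s (zeroS M) (fullS M)).
Proof.
move=> nX hk; have [j [zb [p [pc pid]]]] := cycle_not_boundary Xbnd Xproj nX.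
have Xmax : max_cond (X j) by have [g gP] := fg_gen (Xfg j); apply: gen_max_cond (lp_max loc) gP.
have [phi [phiB [z [u [zc uz]]]]] :=
  cycle_functional loc Xmax (Xproj (i := j)) (@bnd_cyc _ X j) zb pc pid.
have bil : bilinear_map (fun (x : X j) (y : M) => (phi x : A) *: y).
  split=> [y a x x'|x a y y']; first by rewrite linearP scalerDl -scalerA.
  by rewrite scalerDr !scalerA mulrC.
pose f : {linear C j -> M} := tensor_lift bil.
have fE x y : f (pure_tensor x y) = (phi x : A) *: y by apply: tensor_lift_pure.
have fB : imS (diff C (j - 1) j) (fullS _) <=s preS f (seqS t (fullS M)).
  move=> _ [v _ ->]; move: v.
  apply: (@tensor_gen _ _ _ (preS (diff C (j - 1) j) (preS f (seqS t (fullS M))))) => x y.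
  change (seqS t (fullS M) (f (diff C (j - 1) j (pure_tensor x y)))).
  have -> : diff C (j - 1) j (pure_tensor x y) = pure_tensor (diff X (j - 1) j x) y.
    exact: tensor_map_pure.
  rewrite fE; apply: seqS_scale => //; apply/(lp_gen loc)/phiB; by exists x.
have fZ : fullS M <=s imS f (cyc C j).
  move=> y _; exists (pure_tensor z (u *: y)).
    change (diff C j (j + 1) (pure_tensor z (u *: y)) = 0).
    have -> : diff C j (j + 1) (pure_tensor z (u *: y)) =
        pure_tensor (diff X j (j + 1) z) (u *: y) by apply: tensor_map_pure.
    by rewrite zc -[pure_tensor 0 _]/(pure_tensorl (u *: y) 0) linear0.
  by rewrite fE scalerA mulrC uz scale1r.
have gdef : grows k (defect s (diff C (j - 1) j)).
  have := hk (j - 1); rewrite /complex_coh_len subrK; apply: (@grows_le _ _ _ 0%N) => n _.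
  apply: (defect_le loc) => //.
  by have := @bnd_cyc _ C (j - 1); rewrite /cyc subrK.
have gH : grows k (chi s (bnd C j) (cyc C j)).
  have [c cP] := chi_le_coh_len loc (maxC (i := j)) (@bnd_cyc _ C j).
  by apply: (@grows_le _ _ _ 0%N _ (grows_addn c (hk j))) => n _; apply: cP.
have [L LP] := len_primary_le loc.
have gdiff : grows k (fun n => L * len (seqS t (powS s n (fullS M))) (powS s n (fullS M)))%N.
  apply/grows_mul.
  apply: (@grows_le _ _ _ 0%N _ (grows_add gdef (grows_addn 1 gH))) => n _.
  by rewrite addn1; apply: (defect_ge loc (maxC (i := j)) (f := f)) => //; apply: bnd_cyc.
apply: (grows_antidiff (n1 := 0%N) _ gdiff) => n _.
rewrite (chi_diff loc maxM n MZ) addnC leq_add2l; apply: leq_trans (LP _ _ maxM).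
have [] // := @len_inj _ _ _ idfun (addS (zeroS M) (powS s n.+1 (fullS M)))
  (addS (zeroS M) (powS s n (fullS M))) (powS s n.+1 (fullS M)) (powS s n (fullS M)).
- exact: seqS_le.
- exact: (fin_powS loc maxM (n := 1)).
- by move=> _ [_ [y [-> Py ->]]]; rewrite /= add0r.
by move=> y _ Py; apply: addS_r.
Qed.

(** Both bounds for the degree at once: [k] bounds the growth if and only if
[dim H_i < k] for all [i] and [dim M - 1 < k]. *)
Lemma complex_coh_len_growsP k : ~ homotopy_equivalent X (zero_complex A) ->
  (forall i, grows k (complex_coh_len i)) <->
  (forall i, ~ prime_chain (colS (bnd C i) (cyc C i)) k) /\
  ~ prime_chain (colS (zeroS M) (fullS M)) k.+1.
Proof.
move=> nX; split=> [hk|[Hk Mk] i].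
  split=> [i|]; last exact/(growsP loc maxM _ MZ)/complex_coh_len_grows_module.
  apply/(growsP loc (maxC (i := i)) _ (@bnd_cyc _ C i)).
  have [c cP] := chi_le_coh_len loc (maxC (i := i)) (@bnd_cyc _ C i).
  by apply: (@grows_le _ _ _ 0%N _ (grows_addn c (hk i))) => n _; apply: cP.
have gH : grows k (chi s (bnd C i) (cyc C i)).
  by apply/(growsP loc (maxC (i := i)) _ (@bnd_cyc _ C i)).
have gD : grows k (defect s (diff C i (i + 1))).
  apply: (defect_grows loc (maxC (i := i + 1))).
  apply/(growsP loc (maxC (i := i + 1)) _ (@zeroS_sub _ _ _)) => c; apply: Mk.
  apply: prime_chain_mono c => a aM u _.
  have h : fullS (C (i + 1)) <=s preS (GRing.scale a : {linear C (i + 1) -> C (i + 1)}) (zeroS _).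
    move=> v _; move: v; apply: tensor_gen => x y /=.
    by rewrite -pure_tensorZr (aM y I) linear0.
  exact: h.
apply: (@grows_le _ _ _ 0%N _ (grows_add gH gD)) => n _.
exact: (coh_len_le loc (maxC (i := i)) (maxC (i := i + 1)) (@bnd_cyc _ C i)).
Qed.

End BoundedProjective.

(** * The degree of [psi] *)

Lemma sum_natE (T : Type) (r : seq T) (f : T -> nat) :
  (\sum_(i <- r) ((f i)%:R%:E : \bar rat) = ((\sum_(i <- r) f i)%N%:R)%:E)%E.
Proof. by rewrite sumEFin natr_sum. Qed.

(** The interval of degrees outside of which a bounded complex vanishes. *)
Definition degrees (n : nat) : seq int := [seq k%:Z - n%:Z | k <- iota 0 (n + n).+1].

Lemma degrees_uniq n : uniq (degrees n).
Proof. by rewrite map_inj_uniq ?iota_uniq // => i j /addIr []. Qed.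

Lemma degreesP n (i : int) : i \notin degrees n -> (n < `|i|)%N.
Proof.
apply: contraR => ni; apply/mapP; exists (absz (i + n%:Z)); last by lia.
by rewrite mem_iota; lia.
Qed.

Section Psi.
Variables (A : comNzRingType) (m : sub A^o) (s t : seq A) (I : {pred A}).
Hypotheses (loc : local_primary m s t) (sI : forall a : A, a \in I <-> seqS s (fullS A^o) a).
Variables (X : complex A) (M : lmodType A).
Hypotheses (Mfg : fg_module M) (XK : in_Kb_proj X).
Variable n0 : nat.
Hypothesis Xn0 : forall (i : int) (x : X i), (n0 < `|i|)%N -> x = 0.
Let C : complex A := tensor_complex X M.

Lemma tensor_complex_vanish i (u : C i) : i \notin degrees n0 -> u = 0.
Proof.
move=> /degreesP ni.
have : fullS (C i) <=s zeroS (C i).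
  move=> v _; move: v; apply: tensor_gen => x y /=; rewrite (Xn0 x ni).
  by rewrite -[pure_tensor 0 _]/(pure_tensorl y 0) linear0.
exact.
Qed.

Lemma complex_coh_len_vanish i n : i \notin degrees n0 -> complex_coh_len s X M i n = 0%N.
Proof.
move=> ni; rewrite /complex_coh_len /coh_len; set V := addS _ _; set U := preS _ _.
have UV : U <=s V by move=> u _; rewrite (tensor_complex_vanish u ni); apply: sub0.
by have [] := fin0 UV.
Qed.

Lemma psi_coh_len n : psi I M X n = ((\sum_(i <- degrees n0) complex_coh_len s X M i n)%N%:R)%:E.
Proof.
have Xfg i : fg_module (X i) := (XK.2 i).1.
rewrite -sum_natE fsbig_seq ?degrees_uniq //; apply/esym.
rewrite (eq_fsbigr (fun i => Defs.length (cohomology (tensor_complex X (mod_pow I M n)) i))).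
  apply: fsbig_widen => // i /= [_ /negP ni].
  rewrite (cohomology_mod_pow loc sI Xfg Mfg) -/(complex_coh_len s X M i n).
  by rewrite complex_coh_len_vanish.
by move=> i _; rewrite (cohomology_mod_pow loc sI Xfg Mfg).
Qed.

End Psi.

(** The degree of a non-zero [p] is determined by the [k] with [size p <= k]. *)
Lemma poly_degree_eq (P Q : set nat) (p : {poly rat}) :
  p != 0 ->
  (forall k, (size p <= k)%N <-> (sup_nat P < k%:R%:E)%E /\ (sup_nat Q < k.+1%:R%:E)%E) ->
  poly_degree p = Order.max (sup_nat P) (sup_nat Q - 1)%E.
Proof.
move=> p0 pk; rewrite /poly_degree (negPf p0).
have sp : size p = (size p).-1.+1 by rewrite prednK // size_poly_gt0.
set d := (size p).-1 in sp *.
have [/sup_nat_lt Pd /sup_nat_lt Qd] : (sup_nat P < d.+1%:R%:E)%E /\ (sup_nat Q < d.+2%:R%:E)%E.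
  by apply/pk; rewrite sp.
have nd : ~ ((sup_nat P < d%:R%:E)%E /\ (sup_nat Q < d.+1%:R%:E)%E) by move/pk; rewrite sp ltnn.
have sub1 (a : \bar rat) : (a <= d.+1%:R%:E)%E -> (a - 1 <= d%:R%:E)%E.
  by move=> h; rewrite leeBlDr // -EFinD natr1.
have sub1' (a : \bar rat) : (d.+1%:R%:E <= a)%E -> (d%:R%:E <= a - 1)%E.
  by move=> h; rewrite leeBrDr // -EFinD natr1.
apply/eqP; rewrite eq_le; apply/andP; split; last first.
  rewrite ge_max; apply/andP; split.
    by apply: sup_nat_le => j /Pd; rewrite ltnS lee_fin ler_nat.
  by apply: sub1; apply: sup_nat_le => j /Qd; rewrite ltnS lee_fin ler_nat.
rewrite le_max; apply/orP; have [Pl|Pl] := ltP (sup_nat P) (d%:R%:E)%E; last by left.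
right; apply: sub1'; rewrite leNgt; apply/negP => Ql; apply: nd; by split.
Qed.

Local Open Scope ereal_scope.

Theorem theorem1p8 (A : comNzRingType) (m : {pred A}) (M : lmodType A)
    (I : {pred A}) (X : complex A) :
  noetherian A -> local_ring m ->
  fg_module M -> 0 < krull_dim M ->
  m_primary m I ->
  in_Kb_proj X -> ~ homotopy_equivalent X (zero_complex A) ->
  s_inv I M X =
    Order.max (krull_dim (total_cohomology (tensor_complex X M)))
              (krull_dim M - 1).
Proof.
move=> noethA locA Mfg M0 mI XK nX.
have [m' [s [t [loc sI]]]] := local_primary_of noethA locA mI.
have [n0 Xn0] := XK.1.
pose f n := (\sum_(i <- degrees n0) complex_coh_len s X M i n)%N.
have psiE n : psi I M X n = ((f n)%:R)%:E by apply: psi_coh_len loc sI _ _ Mfg XK _ Xn0 n.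
have fpoly : polytype (fun n => (f n)%:R).
  have := polytype_sum (degrees n0) (fun i => complex_coh_len_poly loc Mfg XK i).
  by apply: (@polytype_ext _ _ 0%N) => n _; rewrite natr_sum.
rewrite /s_inv /poly_type_degree; set p := xget _ _.
have [n1 pP] : eventually_poly (psi I M X) p.
  apply: xgetPex; have [q [n1 fq]] := fpoly.
  by exists q, n1 => n /fq qE; rewrite psiE qE.
have fp n : (n1 <= n)%N -> (f n)%:R = p.[n%:R] by move/pP; rewrite psiE => -[].
have pk k : (size p <= k)%N <->
    (krull_dim (total_cohomology (tensor_complex X M)) < k%:R%:E) /\
    (krull_dim M < k.+1%:R%:E).
  rewrite (total_dim_lt k (r := degrees n0)); last first.
    by move=> i u; apply: tensor_complex_vanish.
  rewrite krull_dimP -(complex_coh_len_growsP loc Mfg XK k nX) -(size_grows _ fp).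
  split=> [fk i|hk]; last exact: grows_sum.
  have [ir|ir] := boolP (i \in degrees n0); last first.
    by exists 0%N, 0%N => n _; rewrite (complex_coh_len_vanish _ _ Xn0).
  apply: (@grows_le _ _ _ 0%N _ fk) => n _; rewrite /f.
  by rewrite (bigD1_seq i) ?degrees_uniq //= leq_addr.
apply: poly_degree_eq (pk); apply/eqP => p0.
have [|_ /sup_nat_lt M1] := (pk 0%N).1; first by rewrite p0 size_poly0.
move: M0; rewrite ltNge => /negP; apply; apply: sup_nat_le => j /M1.
by rewrite ltnS leqn0 => /eqP ->.
Qed.
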